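(* Let $\alpha\in(0,\pi/2)$ and $\rho\in(0,0.11]$. There are constants $0<c\le C<\infty$, depending only on $\alpha$ and $\rho$, such that for every $d\ge2$ and every $\sigma>0$, the Cartesian product cone $$K_\times=\mathrm{Circ}_{d-1}(\alpha)\times\mathbb{R}\subset\mathbb{R}^d,\qquad \mathrm{Circ}_{d-1}(\alpha)=\{\theta\in\mathbb{R}^{d-1}:\theta_1\ge\|\theta\|_2\cos\alpha\},$$ satisfies $$c\,\sigma^2\sqrt d\ \le\ \epsilon^2_{\mathrm{GLR}}(\{0\},K_\times;\rho)\ \le\ C\,\sigma^2\sqrt d\qquad\text{and}\qquad c\,\sigma^2\ \le\ \epsilon^2_{\mathrm{OPT}}(\{0\},K_\times;\rho)\ \le\ C\,\sigma^2 .$$ In particular, the squared testing radius of the GLRT is sub-optimal by a factor of order $\sqrt d$ for this problem.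
   Context: Model: one observes $y = \theta + \sigma g \in \mathbb{R}^d$, with $\theta\in\mathbb{R}^d$ unknown, $g \sim N(0,I_d)$ and $\sigma>0$ known; $\mathbb{P}_\theta$ and $\mathbb{E}_\theta$ denote the law $N(\theta,\sigma^2 I_d)$ of $y$ (also its density) and its expectation. For closed convex cones $C_1\subset C_2$ and $\epsilon>0$, the uniform error of a measurable test $\psi:\mathbb{R}^d\to\{0,1\}$ is $$\mathcal{E}(\psi;C_1,C_2,\epsilon) = \sup_{\theta\in C_1}\mathbb{E}_\theta[\psi(y)] + \sup_{\theta\in C_2\setminus B_2(C_1;\epsilon)}\mathbb{E}_\theta[1-\psi(y)],$$ where $B_2(C_1;\epsilon) = \{\theta : \min_{u\in C_1}\|\theta-u\|_2\le\epsilon\}$. Generalized likelihood ratio test (GLRT): $T(y) = -2\log\left(\frac{\sup_{\theta\in C_1}\mathbb{P}_\theta(y)}{\sup_{\theta\in C_2}\mathbb{P}_\theta(y)}\right)$ and $\phi_\beta(y) = 1$ if $T(y)\ge\beta$, $\phi_\beta(y)=0$ otherwise. Testing radii: $\epsilon_{\mathrm{OPT}}(C_1,C_2;\rho) = \inf\{\epsilon>0 : \inf_\psi\mathcal{E}(\psi;C_1,C_2,\epsilon)\le\rho\}$ (infimum over all measurable tests) and $\epsilon_{\mathrm{GLR}}(C_1,C_2;\rho) = \inf\{\epsilon>0 : \inf_{\beta\in\mathbb{R}}\mathcal{E}(\phi_\beta;C_1,C_2,\epsilon)\le\rho\}$. *)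

(* Defs.v *)
From HB Require Import structures.
From mathcomp Require Import all_boot all_order all_algebra.
From mathcomp Require Import all_classical all_reals all_analysis.
From mathcomp Require Import measurable_realfun.

Set Implicit Arguments.
Unset Strict Implicit.
Unset Printing Implicit Defensive.

Import Order.TTheory GRing.Theory Num.Theory.
Import numFieldNormedType.Exports.

Local Open Scope classical_set_scope.
Local Open Scope ring_scope.

(* R^n is n.-tuple R with its product sigma-algebra: this is the only form of
   R^n for which the library provides a measurable structure. *)

Section gaussian_location_model.
Context {R : realType}.

Definition norm2 n (x : n.-tuple R) : R :=
  Num.sqrt (\sum_(i < n) tnth x i ^+ 2).

Definition vsub n (x y : n.-tuple R) : n.-tuple R :=
  [tuple tnth x i - tnth y i | i < n].

Definition vzero n : n.-tuple R := [tuple 0 | i < n].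

(* measurableTypeR R is the copy of R that carries normal_prob. *)
Definition consv n (p : measurableTypeR R * n.-tuple R) : n.+1.-tuple R :=
  [tuple of (p.1 : R) :: p.2].

Lemma measurable_consv n :
  measurable_fun [set: measurableTypeR R * n.-tuple R] (@consv n).
Proof.
apply: (@measurable_cons _ _ _ R
  (fun p : measurableTypeR R * n.-tuple R => p.1 : R)) => //.
exact: (@measurable_fst _ _ (measurableTypeR R) (n.-tuple R)).
Qed.

HB.instance Definition _ n :=
  isMeasurableFun.Build _ _ _ _ (@consv n) (@measurable_consv n).

(* N(0, I_n): the n-fold product of N(0, 1). *)
Fixpoint std_gauss n : probability (n.-tuple R) R :=
  match n with
  | 0%N => dirac ([tuple] : 0.-tuple R)
  | m.+1 =>
      distribution (normal_prob (0 : R) 1 \x std_gauss m)%E (@consv m)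
  end.

(* y = theta + sigma g *)
Definition observation n (theta : n.-tuple R) (sigma : R) (g : n.-tuple R) :
  n.-tuple R := [tuple tnth theta i + sigma * tnth g i | i < n].

Lemma measurable_observation n (theta : n.-tuple R) (sigma : R) :
  measurable_fun [set: n.-tuple R] (observation theta sigma).
Proof.
apply/measurable_fun_tnthP => i.
rewrite (_ : _ \o _ = fun g => tnth theta i + sigma * tnth g i); last first.
  by apply/funext => g /=; rewrite tnth_mktuple.
apply: measurable_funD => //; apply: measurable_funM => //.
exact: measurable_tnth.
Qed.

HB.instance Definition _ n (theta : n.-tuple R) (sigma : R) :=
  isMeasurableFun.Build _ _ _ _ (observation theta sigma)
    (measurable_observation theta sigma).

(* P_theta = N(theta, sigma^2 I_n) *)
Definition gauss_law n (sigma : R) (theta : n.-tuple R) :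
  probability (n.-tuple R) R :=
  distribution (std_gauss n) (observation theta sigma).

(* The density of P_theta (for sigma > 0). *)
Definition gauss_pdf n (sigma : R) (theta y : n.-tuple R) : R :=
  \prod_(i < n) normal_pdf (tnth theta i) sigma (tnth y i).

Section testing.
Context {n : nat}.
Variables (sigma : R) (C1 C2 : set (n.-tuple R)).

(* B_2(C; eps); the infimum is the minimum when C is closed and nonempty. *)
Definition neighborhood2 (C : set (n.-tuple R)) (eps : R) : set (n.-tuple R) :=
  [set theta |
    (ereal_inf [set (norm2 (vsub theta u))%:E | u in C] <= eps%:E)%E].

(* A test is a boolean function, true meaning rejection. Both suprema are taken
   in the extended reals, so a supremum over the empty set is -oo. *)
Definition uniform_error (psi : n.-tuple R -> bool) (eps : R) : \bar R :=
  (ereal_sup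
     [set 'E_(gauss_law sigma theta)[fun y => (psi y)%:R] | theta in C1] +
   ereal_sup
     [set 'E_(gauss_law sigma theta)[fun y => (1 - (psi y)%:R)%R] |
       theta in C2 `\` neighborhood2 C1 eps])%E.

Definition glr_statistic (y : n.-tuple R) : R :=
  - 2 * ln (sup [set gauss_pdf sigma theta y | theta in C1] /
            sup [set gauss_pdf sigma theta y | theta in C2]).

Definition glr_test (beta : R) (y : n.-tuple R) : bool :=
  beta <= glr_statistic y.

Definition eps_OPT (rho : R) : \bar R :=
  ereal_inf [set eps%:E | eps in [set eps : R | 0 < eps /\
    (ereal_inf [set uniform_error psi eps |
       psi in [set psi | measurable_fun [set: n.-tuple R] psi]]
     <= rho%:E)%E]].

Definition eps_GLR (rho : R) : \bar R :=
  ereal_inf [set eps%:E | eps in [set eps : R | 0 < eps /\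
    (ereal_inf [set uniform_error (glr_test beta) eps | beta in [set: R]]
     <= rho%:E)%E]].

End testing.

(* Circ_{n+1}(alpha) in R^(n+1) *)
Definition circ_cone n (alpha : R) : set (n.+1.-tuple R) :=
  [set theta | tnth theta ord0 >= norm2 theta * cos alpha].

(* A x R in R^(n+1), for A in R^n *)
Definition prod_line n (A : set (n.-tuple R)) : set (n.+1.-tuple R) :=
  [set [tuple of rcons x t] | x in A & t in [set: R]].

(* K_x in R^(n+2) *)
Definition circ_prod_cone n (alpha : R) : set (n.+2.-tuple R) :=
  prod_line (@circ_cone n alpha).

End gaussian_location_model.

Arguments circ_cone {R} n alpha.
Arguments circ_prod_cone {R} n alpha.
Arguments vzero {R} n.

(* Main.v *)
From HB Require Import structures.
Require Import Defs.
From mathcomp Require Import all_boot all_order all_algebra.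
From mathcomp Require Import all_classical all_reals all_analysis.
From mathcomp Require Import measurable_realfun ring lra.

(* Write T y for the squared norm of the projection of y on the cone, so that the
   GLR statistic is T y / sigma^2; rescaling y reduces everything to sigma = 1.
   With s = sin alpha and d = n.+2, T y differs from s^2 |y|^2 by
   O(y_0^2 + y_last^2 + |y_0| |y|), hence T g = s^2 d + O(sqrt d) with high
   probability when g ~ N(0, I_d).

   Upper bound for the GLRT: for theta in the cone,
   T (theta + g) >= T g + |theta|^2 + 2 <theta, g>, so a signal with
   |theta|^2 >> sqrt d leaves the O(sqrt d) window.

   Lower bound for the GLRT: replacing g by e^eta g with eta = tau / sqrt d
   multiplies T g by e^(2 eta), a shift of order tau sqrt d, while it changes the
   probability of any event by O(tau + tau^2), by a pointwise lower bound of the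
   likelihood ratio. A shift t of the last coordinate moves T by t^2 + 2 t g_last
   only, which is smaller when t^2 = u^2 sqrt d with u small; so no threshold
   separates theta = 0 from theta = t e_last. This requires d large; for smaller
   d the bound for arbitrary tests suffices.

   Optimal radius: a large signal in the cone has a large first or last
   coordinate, so thresholding these two coordinates works at radius O(sigma);
   conversely theta = (sigma / 2) e_0 is not detectable by any test.

   The moments of N(0, 1) come from the change of variable x |-> t + lam x: the
   density ratio has mean 1 for all t and lam, and e^u >= 1 + u turns this into
   inequalities that force E x = 0 and E x^2 = 1. *)

Set Implicit Arguments.
Unset Strict Implicit.
Unset Printing Implicit Defensive.

Import Order.TTheory GRing.Theory Num.Theory.
Import numFieldNormedType.Exports.

Local Open Scope classical_set_scope.
Local Open Scope ring_scope.

(** * Affine images of the normal law *)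

Section normal_affine.
Context {R : realType}.
Local Notation mu := (@lebesgue_measure R).
Local Notation N01 := (@normal_prob R 0 1).

(** The Radon-Nikodym derivative of the normal law and [normal_pdf] have the same integral over
    every measurable set, hence agree almost everywhere. *)
Lemma ge0_integral_normal_prob (m s : R) (f : R -> \bar R) :
  measurable_fun [set: R] f -> (forall x, 0 <= f x)%E ->
  (\int[normal_prob m s]_x f x = \int[mu]_x (f x * (normal_pdf m s x)%:E))%E.
Proof.
move=> mf f0.
have dom := @normal_prob_dominates R m s.
rewrite -(Radon_Nikodym_SigmaFinite.change_of_variables dom)//.
have mRN := measurable_int _ (Radon_Nikodym_SigmaFinite.f_integrable dom).
have mpdf : measurable_fun [set: R] (fun x => (normal_pdf m s x)%:E).
  by apply/measurable_EFinP; exact: measurable_normal_pdf.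
apply: ge0_ae_eq_integral => //.
- exact: emeasurable_funM.
- exact: emeasurable_funM.
- by move=> x _; rewrite mule_ge0// Radon_Nikodym_SigmaFinite.f_ge0.
- by move=> x _; rewrite mule_ge0// lee_fin normal_pdf_ge0.
- apply: ae_eqe_mul2l => /=; apply: integral_ae_eq => //=.
  + exact: Radon_Nikodym_SigmaFinite.f_integrable.
  + by move=> E _ mE; rewrite -Radon_Nikodym_SigmaFinite.f_integral.
Qed.

(** Uniqueness of Lebesgue measure: the pushforward under the affine map, scaled by [lam], gives
    half-open intervals their length. *)
Lemma lebesgue_measure_affine (t lam : R) (A : set R) : 0 < lam ->
  measurable A ->
  mu A = (lam%:E * mu ((fun x => (t + lam * x)%R) @^-1` A))%E.
Proof.
move=> lam0 mA.
have maff : measurable_fun [set: measurableTypeR R]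
    (fun x => (t + lam * x)%R : measurableTypeR R).
  by apply: measurable_funD => //; exact: measurable_funM.
have lam0' := ltW lam0.
pose p : {measure set (measurableTypeR R) -> \bar R} :=
  measure_function_pushforward__canonical__measure_function_Measure mu maff.
pose m := mscale (NngNum lam0') p.
rewrite (@lebesgue_measure_unique R m)// => _ [[a b]] _ <-.
rewrite /m /mscale /= /pushforward.
pose I : set R := `](a - t) / lam, (b - t) / lam]%classic.
transitivity (lam%:E * mu I)%E; last first.
  congr (_ * mu _)%E; apply/seteqP; split => x; rewrite /I/= !in_itv/=;
    move=> /andP[ax xb]; apply/andP; split.
  - by move: ax; rewrite ltr_pdivrMr//; lra.
  - by move: xb; rewrite ler_pdivlMr//; lra.
  - by rewrite ltr_pdivrMr//; lra.
  - by rewrite ler_pdivlMr//; lra.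
rewrite /I !lebesgue_measure_itv/= !lte_fin ltr_pM2r ?invr_gt0// ltrD2r.
case: ifPn => _; last by rewrite mule0.
by rewrite -!EFinB -EFinM; congr EFin; field; rewrite gt_eqF.
Qed.

Lemma ge0_integral_affine (t lam : R) (f : R -> \bar R) : 0 < lam ->
  measurable_fun [set: R] f -> (forall x, 0 <= f x)%E ->
  (\int[mu]_x f x = lam%:E * \int[mu]_x f (t + lam * x)%R)%E.
Proof.
move=> lam0 mf f0.
have maff : measurable_fun [set: measurableTypeR R]
    (fun x => (t + lam * x)%R : measurableTypeR R).
  by apply: measurable_funD => //; exact: measurable_funM.
have lam0' := ltW lam0.
pose p : {measure set (measurableTypeR R) -> \bar R} :=
  measure_function_pushforward__canonical__measure_function_Measure mu maff.
pose m := mscale (NngNum lam0') p.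
rewrite (@eq_measure_integral _ _ _ _ m); last first.
  by move=> A mA _; exact: (lebesgue_measure_affine t lam0 mA).
rewrite ge0_integral_mscale//=; congr (_ * _)%E.
by rewrite ge0_integral_pushforward.
Qed.

(* The density of N(0, 1) pushed forward by [x |-> t + lam * x], relative to
   N(0, 1). *)
Definition affine_ratio (t lam x : R) : R :=
  lam^-1 * expR (x ^+ 2 / 2 - ((x - t) / lam) ^+ 2 / 2).

Lemma affine_ratio_ge0 t lam x : 0 < lam -> 0 <= affine_ratio t lam x.
Proof. by move=> l0; rewrite mulr_ge0 ?expR_ge0// invr_ge0 ltW. Qed.

Lemma measurable_affine_ratio t lam :
  measurable_fun [set: R] (affine_ratio t lam).
Proof.
apply: measurable_funM => //; apply: measurableT_comp => //.
apply: measurable_funB; apply: measurable_funM => //.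
apply: measurable_funX; apply: measurable_funM => //.
exact: measurable_funB.
Qed.

Lemma ge0_integral_normal_affine (t lam : R) (f : R -> \bar R) : 0 < lam ->
  measurable_fun [set: R] f -> (forall x, 0 <= f x)%E ->
  (\int[N01]_x f (t + lam * x)%R =
   \int[N01]_x (f x * (affine_ratio t lam x)%:E))%E.
Proof.
move=> l0 mf f0.
have maff : measurable_fun [set: R] (fun x => (t + lam * x)%R).
  by apply: measurable_funD => //; exact: measurable_funM.
have mpdf (g : R -> R) : measurable_fun [set: R] g ->
    measurable_fun [set: R] (fun x => (normal_pdf 0 1 (g x))%:E).
  move=> mg; apply/measurable_EFinP.
  by apply: measurableT_comp => //; exact: measurable_normal_pdf.
have mratio : measurable_fun [set: R] (fun x => (affine_ratio t lam x)%:E).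
  by apply/measurable_EFinP; exact: measurable_affine_ratio.
rewrite !ge0_integral_normal_prob//; first last.
- by apply: measurableT_comp.
- by move=> x; rewrite mule_ge0// lee_fin affine_ratio_ge0.
- exact: emeasurable_funM.
(* Up to the factor [lam^-1], [h] is [f] times the density of [t + lam * x]; the affine substitution
   under Lebesgue measure then restores the factor. *)
pose h y := (f y * (normal_pdf 0 1 ((y - t) / lam))%:E)%E.
have mh : measurable_fun [set: R] h.
  apply: emeasurable_funM => //; apply: mpdf.
  by apply: measurable_funM => //; exact: measurable_funB.
have h0 x : (0 <= h x)%E by rewrite mule_ge0// lee_fin normal_pdf_ge0.
transitivity (\int[mu]_x h (t + lam * x)%R)%E.
  apply: eq_integral => x _; rewrite /h; congr (_ * (normal_pdf _ _ _)%:E)%E.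
  by field; rewrite gt_eqF.
have <- : (lam^-1%:E * \int[mu]_x h x = \int[mu]_x h (t + lam * x)%R)%E.
  rewrite (ge0_integral_affine t l0)// muleA -EFinM mulVf ?gt_eqF//.
  by rewrite mul1e.
rewrite -ge0_integralZl_EFin//; last by rewrite invr_ge0 ltW.
apply: eq_integral => x _; rewrite /h /affine_ratio muleCA -muleA -!EFinM.
congr (_ * _%:E)%E; rewrite !normal_pdfE ?oner_neq0// /normal_fun.
rewrite (_ : expR (- ((x - t) / lam - 0) ^+ 2 / _) =
  expR (x ^+ 2 / 2 - ((x - t) / lam) ^+ 2 / 2) *
  expR (- (x - 0) ^+ 2 / (1 ^+ 2 *+ 2))); last first.
  by rewrite -expRD; congr expR; rewrite expr1n !subr0; field; rewrite gt_eqF.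
by rewrite !mulrA; congr (_ * _); rewrite mulrAC.
Qed.

End normal_affine.

(** * Moments of the standard normal law *)

Section normal_moments.
Context {R : realType}.
Local Notation N01 := (@normal_prob R 0 1).

Lemma integral_affine_ratio (t lam : R) : 0 < lam ->
  (\int[N01]_x (affine_ratio t lam x)%:E = 1)%E.
Proof.
move=> l0; transitivity (\int[N01]_x (1 * (affine_ratio t lam x)%:E))%E.
  by apply: eq_integral => x _; rewrite mul1e.
rewrite -(@ge0_integral_normal_affine _ t lam (fun=> 1%E))//.
by rewrite integral_cst//= mul1e probability_setT.
Qed.

Lemma integrable_affine_ratio (t lam : R) : 0 < lam ->
  N01.-integrable [set: R] (fun x => (affine_ratio t lam x)%:E).
Proof.
move=> l0; apply/integrableP; split.
  by apply/measurable_EFinP; exact: measurable_affine_ratio.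
under eq_integral do rewrite gee0_abs ?lee_fin ?affine_ratio_ge0//.
by rewrite integral_affine_ratio// ltry.
Qed.

Lemma Rintegral_affine_ratio (t lam : R) : 0 < lam ->
  \int[N01]_x affine_ratio t lam x = 1.
Proof. by move=> l0; rewrite /Rintegral integral_affine_ratio. Qed.

(** For [t = 0] and [lam = sqrt 2] the density ratio is [e^(x^2/4) / sqrt 2], and
    [e^(x^2/4) = (e^(x^2/8))^2 >= x^4 / 64]. The ratio is integrable, so it dominates. *)
Lemma integrable_normal_exp4 : N01.-integrable [set: R] (fun x => (x ^+ 4)%:E).
Proof.
have s2 : 0 < Num.sqrt 2 :> R by rewrite sqrtr_gt0.
apply: (@le_integrable _ _ _ N01 _ measurableT _
  (fun x => ((64 * Num.sqrt 2)%:E * (affine_ratio 0 (Num.sqrt 2) x)%:E)%E)).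
- by apply/measurable_EFinP; exact: exprn_measurable.
- move=> x _; rewrite -EFinM lee_fin ger0_norm ?exprn_even_ge0//.
  rewrite ger0_norm; last first.
    by rewrite mulr_ge0 ?affine_ratio_ge0// mulr_ge0// sqrtr_ge0.
  rewrite /affine_ratio subr0 expr_div_n sqr_sqrtr// mulrA mulfK ?gt_eqF//.
  have -> : x ^+ 2 / 2 - x ^+ 2 / 2 / 2 = x ^+ 2 / 8 + x ^+ 2 / 8 by field.
  rewrite expRD.
  have h := expR_ge1Dx (x ^+ 2 / 8).
  have x0 : 0 <= x ^+ 2 / 8 by rewrite divr_ge0 ?sqr_ge0.
  have -> : x ^+ 4 = 64 * (x ^+ 2 / 8 * (x ^+ 2 / 8)) by field.
  by rewrite ler_pM2l//; apply: ler_pM => //; lra.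
- exact/integrableZl/integrable_affine_ratio.
Qed.

Lemma integrable_normal_exp k : (k <= 4)%N ->
  N01.-integrable [set: R] (fun x => (x ^+ k)%:E).
Proof.
move=> k4.
apply: (@le_integrable _ _ _ N01 _ measurableT _
  (fun x => (1%:E + (x ^+ 4)%:E)%E)).
- by apply/measurable_EFinP; exact: exprn_measurable.
- move=> x _; rewrite -EFinD lee_fin normrX.
  have x4 : 0 <= x ^+ 4 by rewrite exprn_even_ge0.
  rewrite [leRHS]ger0_norm ?addr_ge0//.
  have [x1|x1] := leP `|x| 1; first by rewrite (le_trans (exprn_ile1 _ _ _))// lerDl.
  rewrite -(ger0_norm x4) normrX.
  have := ler_weXn2l (ltW x1) k4.
  lra.
- apply: integrableD => //; last exact: integrable_normal_exp4.
  exact: finite_measure_integrable_cst.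
Qed.

Let m1 := \int[N01]_x x.
Let m2 := \int[N01]_x (x ^+ 2).

Let integ1 : N01.-integrable [set: R] (EFin \o (fun x : R => x)).
Proof. exact: (@integrable_normal_exp 1). Qed.

Let integ2 : N01.-integrable [set: R] (EFin \o (fun x : R => x ^+ 2)).
Proof. exact: (@integrable_normal_exp 2). Qed.

Let integc (c : R) : N01.-integrable [set: R] (EFin \o (fun=> c)).
Proof. exact: finite_measure_integrable_cst. Qed.

Let integZ (c : R) f : N01.-integrable [set: R] (EFin \o f) ->
  N01.-integrable [set: R] (EFin \o (fun x : R => c * f x)).
Proof. by move=> /(integrableZl measurableT c). Qed.

Let integD (f g : R -> R) : N01.-integrable [set: R] (EFin \o f) ->
  N01.-integrable [set: R] (EFin \o g) ->
  N01.-integrable [set: R] (EFin \o (fun x : R => f x + g x)).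
Proof. by move=> intf intg; have := integrableD measurableT intf intg. Qed.

Let Rcst (c : R) : \int[N01]_x c = c.
Proof. by rewrite Rintegral_cst//= probability_setT mulr1. Qed.

(** The density ratio of a shift by [t] is [e^(t x - t^2/2) >= 1 + t x - t^2/2]. Integrating gives
    [t * m1 <= t^2/2] for every [t], and [t = m1] leaves only [m1 = 0]. *)
Lemma Rintegral_normal_id : \int[N01]_x x = 0.
Proof.
rewrite -/m1.
have h t : 1 + t * m1 - t ^+ 2 / 2 <= 1.
  rewrite -[leRHS](Rintegral_affine_ratio t ltr01).
  have -> : 1 + t * m1 - t ^+ 2 / 2 = \int[N01]_x (t * x + (1 - t ^+ 2 / 2)).
    by rewrite RintegralD//; [rewrite RintegralZl// Rcst -/m1; ring|exact: integZ].
  apply: le_Rintegral => //; [by apply: integD => //; exact: integZ| |].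
    exact: integrable_affine_ratio.
  move=> x _; rewrite /affine_ratio invr1 mul1r mulr1.
  apply: le_trans (expR_ge1Dx _); rewrite le_eqVlt; apply/orP; left; apply/eqP.
  by field.
have := h m1; nra.
Qed.

(** With [lam = u^-1] the density ratio is [u e^((1 - u^2) x^2/2)], and the linear lower bound of
    the exponential integrates to [h]. Once the factor [1 - u] is divided out, [u] close to 1 from
    below excludes [m2 > 1], and from above [m2 < 1]; explicit values of [u] replace the limit. *)
Lemma Rintegral_normal_sqr : \int[N01]_x (x ^+ 2) = 1.
Proof.
rewrite -/m2.
have m20 : 0 <= m2 by apply: Rintegral_ge0 => x _; exact: sqr_ge0.
have h u : 0 < u -> u * (1 + (1 - u ^+ 2) / 2 * m2) <= 1.
  move=> u0; have v0 : 0 < u^-1 by rewrite invr_gt0.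
  rewrite -[leRHS](Rintegral_affine_ratio 0 v0).
  have -> : u * (1 + (1 - u ^+ 2) / 2 * m2) =
      \int[N01]_x (u * (1 - u ^+ 2) / 2 * x ^+ 2 + u).
    by rewrite RintegralD//; [rewrite RintegralZl// Rcst -/m2; field|exact: integZ].
  apply: le_Rintegral => //; [by apply: integD => //; exact: integZ| |].
    exact: integrable_affine_ratio.
  move=> x _; rewrite /affine_ratio invrK subr0.
  have := expR_ge1Dx (x ^+ 2 / 2 - (x * u) ^+ 2 / 2).
  rewrite -(ler_pM2l u0); apply: le_trans.
  by rewrite le_eqVlt; apply/orP; left; apply/eqP; field.
apply/eqP; rewrite eq_le; apply/andP; split; rewrite leNgt; apply/negP => m2lt.
(* Case [1 < m2]: this [u] is below 1, and the inequality left after division becomes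
   [(3 m2 - 1)(m2 - 1) <= 0]. *)
- have u0 : 0 < (1 + m2) / (2 * m2) by apply: divr_gt0; lra.
  have := h _ u0; set u := (_ / _) in u0 *.
  have uE : u * (2 * m2) = 1 + m2 by rewrite /u divfK// gt_eqF//; lra.
  have u1 : 0 < 1 - u by rewrite subr_gt0 /u ltr_pdivrMr; lra.
  rewrite -subr_ge0 (_ : 1 - _ = (1 - u) * (1 - u * m2 * (1 + u) / 2)).
    rewrite pmulr_rge0// (_ : u * m2 = (1 + m2) / 2) => [h1|]; last by lra.
    have : 0 <= m2 * (1 - (1 + m2) / 2 * (1 + u) / 2) by rewrite mulr_ge0.
    nra.
  by field.
(* Case [m2 < 1]: this [u] exceeds 1, while the remaining inequality [(2 - u)(1 + u) >= 2] forces
   [u <= 1]. *)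
- have u0 : 0 < 2 / (1 + m2) by apply: divr_gt0; lra.
  have := h _ u0; set u := (_ / _) in u0 *.
  have uE : u * (1 + m2) = 2 by rewrite /u divfK// gt_eqF//; lra.
  have u1 : 0 < u - 1 by rewrite subr_gt0 /u ltr_pdivlMr; lra.
  rewrite -subr_ge0 (_ : 1 - _ = (u - 1) * (u * m2 * (1 + u) / 2 - 1)).
    rewrite pmulr_rge0// (_ : u * m2 = 2 - u) => [h1|]; last by lra.
    nra.
  by field.
Qed.

(** The variance of the square of a standard normal variable, kept symbolic; the constants below are
    expressed through it. *)
Definition normal_kurt : R := \int[N01]_x ((x ^+ 2 - 1) ^+ 2).

Lemma normal_kurt_ge0 : 0 <= normal_kurt.
Proof. by apply: Rintegral_ge0 => x _; exact: sqr_ge0. Qed.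

Let integ4 : N01.-integrable [set: R] (EFin \o (fun x : R => (x ^+ 2 - 1) ^+ 2)).
Proof.
rewrite (_ : (fun x => _) = fun x : R => x ^+ 4 + ((-2) * x ^+ 2 + 1)).
  apply: integD; first exact: integrable_normal_exp4.
  by apply: integD => //; exact: integZ.
by apply/funext => x; ring.
Qed.

(** This shape covers the one-coordinate integrals behind both second moments: [e = 0] for linear
    forms, [e = 1] for the centred squared norm. *)
Lemma integral_normal_poly (a b c e : R) :
  (\int[N01]_x (e * (x ^+ 2 - 1) ^+ 2 + c * x ^+ 2 + b * x + a)%:E =
   (e * normal_kurt + c + a)%:E)%E.
Proof.
have i4 := integZ e integ4; have i2 := integZ c integ2; have i1 := integZ b integ1.
have i42 := integD i4 i2; have i421 := integD i42 i1.
have int := integD i421 (integc a).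
rewrite -[LHS]fineK; last exact: integrable_fin_num int.
congr EFin; rewrite -/(Rintegral _ _ _).
rewrite RintegralD// RintegralD// RintegralD// !RintegralZl// Rcst.
by rewrite Rintegral_normal_id Rintegral_normal_sqr mulr0 addr0 mulr1.
Qed.

End normal_moments.

(** * The standard Gaussian measure on R^n *)

Section std_gauss_theory.
Context {R : realType}.
Local Notation N01 := (@normal_prob R 0 1).

Lemma ge0_integral_std_gaussS n (f : n.+1.-tuple R -> \bar R) :
  measurable_fun [set: n.+1.-tuple R] f -> (forall x, 0 <= f x)%E ->
  (\int[std_gauss n.+1]_y f y =
   \int[std_gauss n]_z \int[N01]_x f (consv (x, z)))%E.
Proof.
move=> mf f0; rewrite ge0_integral_distribution//.
have mfc := measurableT_comp mf (@measurable_consv R n).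
rewrite (@fubini_tonelli1 _ _ _ _ _ _ _ (f \o @consv R n)) //; last by move=> x /=.
rewrite /fubini_F (@fubini_tonelli _ _ _ _ _ _ _ (f \o @consv R n)) //.
by move=> x /=.
Qed.

Lemma tnth_consv0 n (x : R) (z : n.-tuple R) : tnth (consv (x, z)) ord0 = x.
Proof. by []. Qed.

Lemma tnth_consvS n (x : R) (z : n.-tuple R) i :
  tnth (consv (x, z)) (lift ord0 i) = tnth z i.
Proof. by rewrite tnthS; congr tnth; apply/val_inj. Qed.

Lemma measurable_sum_tnth n (h : 'I_n -> R -> R) :
  (forall i, measurable_fun [set: R] (h i)) ->
  measurable_fun [set: n.-tuple R] (fun g => \sum_(i < n) h i (tnth g i)).
Proof.
move=> mh; apply: measurable_sum => i.
by apply: measurableT_comp => //; exact: measurable_tnth.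
Qed.

(** Variances of independent centred variables add. The third hypothesis encodes mean 0 and variance
    [v i]; [c] and [s] absorb the other coordinates during the induction, and the integrand stays
    nonnegative, so Tonelli applies. *)
Lemma integral_sqr_sum n (h : 'I_n -> R -> R) (v : 'I_n -> R) (c s : R) :
  (forall i, measurable_fun [set: R] (h i)) -> (forall i, 0 <= v i) ->
  (forall i c s, 0 <= c ->
    (\int[N01]_x (c + (h i x + s) ^+ 2)%:E = (c + v i + s ^+ 2)%:E)%E) ->
  0 <= c ->
  (\int[std_gauss n]_g (c + (\sum_(i < n) h i (tnth g i) + s) ^+ 2)%:E =
   (c + \sum_(i < n) v i + s ^+ 2)%:E)%E.
Proof.
elim: n h v c s => [|n IHn] h v c s mh v0 hv c0.
  under eq_integral do rewrite big_ord0 add0r.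
  by rewrite integral_cst//= probability_setT mule1 big_ord0 addr0.
rewrite ge0_integral_std_gaussS; first last.
- by move=> x; rewrite lee_fin addr_ge0// sqr_ge0.
- apply/measurable_EFinP; apply: measurable_funD => //.
  apply: measurable_funX; apply: measurable_funD => //.
  exact: measurable_sum_tnth.
transitivity (\int[std_gauss n]_z
    (c + v ord0 + (\sum_(i < n) h (lift ord0 i) (tnth z i) + s) ^+ 2)%:E)%E.
  apply: eq_integral => z _; rewrite -hv//; apply: eq_integral => x _.
  rewrite big_ord_recl tnth_consv0 -(addrA (h _ x)).
  by under eq_bigr => i _ do rewrite tnth_consvS.
rewrite (IHn (fun i => h (lift ord0 i)) (fun i => v (lift ord0 i)))//.
- by rewrite big_ord_recl addrA.
- by move=> i c' s' c'0; exact: hv.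
- by rewrite addr_ge0.
Qed.

Lemma integral_std_gauss_dot n (theta : n.-tuple R) :
  (\int[std_gauss n]_g ((\sum_(i < n) tnth theta i * tnth g i) ^+ 2)%:E =
   (\sum_(i < n) tnth theta i ^+ 2)%:E)%E.
Proof.
have := @integral_sqr_sum n (fun i x => tnth theta i * x)
  (fun i => tnth theta i ^+ 2) 0 0.
rewrite expr0n addr0 add0r => <- //.
- by apply: eq_integral => g _; rewrite add0r addr0.
- by move=> i; exact: measurable_funM.
- by move=> i; exact: sqr_ge0.
- move=> i c s c0.
  have := @integral_normal_poly R (c + s ^+ 2) (2 * tnth theta i * s)
    (tnth theta i ^+ 2) 0.
  rewrite mul0r add0r (addrC (tnth theta i ^+ 2)) addrAC => <-.
  by apply: eq_integral => x _; congr EFin; ring.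
Qed.

Lemma integral_std_gauss_chi2 n :
  (\int[std_gauss n]_g ((\sum_(i < n) (tnth g i ^+ 2 - 1)) ^+ 2)%:E =
   (@normal_kurt R *+ n)%:E)%E.
Proof.
have := @integral_sqr_sum n (fun i x => x ^+ 2 - 1) (fun i => normal_kurt) 0 0.
rewrite sumr_const card_ord expr0n addr0 add0r => <- //.
- by apply: eq_integral => g _; rewrite add0r addr0.
- by move=> i; apply: measurable_funB => //; exact: exprn_measurable.
- by move=> i; exact: normal_kurt_ge0.
- move=> i c s c0.
  have := @integral_normal_poly R (c + s ^+ 2 - 2 * s) 0 (2 * s) 1.
  rewrite mul1r.
  rewrite (_ : normal_kurt + _ + _ = c + normal_kurt + s ^+ 2); last by ring.
  by move=> <-; apply: eq_integral => x _; congr EFin; ring.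
Qed.

(** The likelihood ratio of [N(theta, lam^2 I)] against [N(0, I)]. *)
Definition affine_lr n (theta : n.-tuple R) (lam : R) (g : n.-tuple R) : R :=
  \prod_(i < n) affine_ratio (tnth theta i) lam (tnth g i).

Lemma affine_lr_ge0 n (theta : n.-tuple R) lam g : 0 < lam ->
  0 <= affine_lr theta lam g.
Proof. by move=> l0; apply: prodr_ge0 => i _; exact: affine_ratio_ge0. Qed.

Lemma measurable_affine_lr n (theta : n.-tuple R) lam :
  measurable_fun [set: n.-tuple R] (affine_lr theta lam).
Proof.
apply: measurable_prod => i _; apply: measurableT_comp.
  exact: measurable_affine_ratio.
exact: measurable_tnth.
Qed.

(** The likelihood ratio is a product over coordinates. The first coordinate is treated by the
    one-dimensional formula with the others frozen; the induction hypothesis then applies to [F],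
    where that coordinate is already integrated out. *)
Lemma ge0_integral_std_gauss_affine n (theta : n.-tuple R) (lam : R)
    (f : n.-tuple R -> \bar R) : 0 < lam ->
  measurable_fun [set: n.-tuple R] f -> (forall x, 0 <= f x)%E ->
  (\int[std_gauss n]_g f (observation theta lam g) =
   \int[std_gauss n]_g (f g * (affine_lr theta lam g)%:E))%E.
Proof.
move=> l0; elim: n theta f => [|n IHn] theta f mf f0.
  apply: eq_integral => g _; rewrite /affine_lr big_ord0 mule1.
  by rewrite [g]tuple0 [observation _ _ _]tuple0.
pose theta' := [tuple tnth theta (lift ord0 i) | i < n].
have mfl : measurable_fun [set: n.+1.-tuple R]
    (fun g => (f g * (affine_lr theta lam g)%:E)%E).
  apply: emeasurable_funM => //.
  by apply/measurable_EFinP; exact: measurable_affine_lr.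
rewrite !ge0_integral_std_gaussS//; first last.
- exact: (measurableT_comp mf (measurable_observation theta lam)).
- by move=> x; rewrite mule_ge0// lee_fin affine_lr_ge0.
pose r := affine_ratio (tnth theta ord0) lam.
have mr : measurable_fun [set: R] (EFin \o r).
  by apply/measurable_EFinP; exact: measurable_affine_ratio.
pose G (p : measurableTypeR R * n.-tuple R) := (f (consv p) * (r p.1)%:E)%E.
have mG : measurable_fun [set: measurableTypeR R * n.-tuple R] G.
  apply: emeasurable_funM; first exact: measurableT_comp mf (@measurable_consv R n).
  apply: (measurableT_comp mr).
  exact: (@measurable_fst _ _ (measurableTypeR R) (n.-tuple R)).
have G0 p : (0 <= G p)%E by rewrite mule_ge0// lee_fin affine_ratio_ge0.
pose F z := (\int[N01]_x G (x, z))%E.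
have F0 z : (0 <= F z)%E by apply: integral_ge0.
have mF : measurable_fun [set: n.-tuple R] F.
  exact: (@measurable_fun_fubini_tonelli_G _ _ _ _ _ N01 G).
transitivity (\int[std_gauss n]_z F (observation theta' lam z))%E.
  apply: eq_integral => z _; rewrite /F.
  rewrite -(@ge0_integral_normal_affine _ (tnth theta ord0) lam
    (fun x => f (consv (x, observation theta' lam z))))//; last first.
    by apply: (measurableT_comp mf); apply: measurableT_comp;
      [exact: measurable_consv|exact: measurable_pair2].
  apply: eq_integral => x _; congr f; apply: eq_from_tnth => i.
  rewrite tnth_mktuple; case: (unliftP ord0 i) => [j|] ->.
    by rewrite !tnth_consvS !tnth_mktuple.
  by rewrite !tnth_consv0.
rewrite IHn//; apply: eq_integral => z _.
rewrite -ge0_integralZr//=; first last.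
- by rewrite lee_fin affine_lr_ge0.
- exact: (measurableT_comp mG (measurable_pair2 z)).
apply: eq_integral => x _; rewrite /G /= -muleA -EFinM; congr (_ * _%:E)%E.
rewrite /affine_lr big_ord_recl tnth_consv0; congr (_ * _).
by apply: eq_bigr => i _; rewrite tnth_consvS tnth_mktuple.
Qed.

End std_gauss_theory.

(** * The GLR statistic of the circular product cone *)

Lemma cos_sin_acute {R : realType} (alpha : R) : 0 < alpha < pi / 2 ->
  [/\ 0 < cos alpha, 0 < sin alpha & cos alpha ^+ 2 + sin alpha ^+ 2 = 1].
Proof.
move=> /andP[a0 a1]; split; last exact: cos2Dsin2.
  by apply: cos_gt0_pihalf; rewrite a1 andbT; lra.
apply: sin_gt0_pi; rewrite a0 (lt_trans a1)//.
by rewrite ltr_pdivrMr// ltr_pMr ?pi_gt0// ltr1n.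
Qed.

Section circular_product_cone.
Context {R : realType} {n : nat}.
Implicit Types (x y z theta g : n.+2.-tuple R) (c s : R).

Definition dot m (x y : m.-tuple R) : R := \sum_(i < m) tnth x i * tnth y i.

Definition nsq m (x : m.-tuple R) : R := \sum_(i < m) tnth x i ^+ 2.

(** The first coordinate is the axis of the circular cone and the last one is the line factor; these
    are the remaining ones, which enter the cone only through their norm. *)
Definition mid_ord (i : 'I_n) : 'I_n.+2 := lift ord0 (widen_ord (leqnSn n) i).

Definition midnorm x : R := Num.sqrt (\sum_(i < n) tnth x (mid_ord i) ^+ 2).

Lemma mid_ord_neq_max i : mid_ord i != ord_max.
Proof. by rewrite -val_eqE /= /bump /= add1n eqSS neq_ltn ltn_ord. Qed.

Lemma mid_ord_neq0 i : mid_ord i != ord0.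
Proof. by []. Qed.

Lemma ord0_neq_max : (ord0 : 'I_n.+2) != ord_max.
Proof. by []. Qed.

Lemma sum_mid (F : 'I_n.+2 -> R) :
  \sum_(i < n.+2) F i = F ord0 + \sum_(i < n) F (mid_ord i) + F ord_max.
Proof.
rewrite big_ord_recl big_ord_recr /= addrA; congr (_ + _ + F _).
exact/val_inj.
Qed.

Lemma midnorm_ge0 x : 0 <= midnorm x. Proof. exact: sqrtr_ge0. Qed.

Lemma sqr_midnorm x : midnorm x ^+ 2 = \sum_(i < n) tnth x (mid_ord i) ^+ 2.
Proof. by rewrite sqr_sqrtr// sumr_ge0// => i _; exact: sqr_ge0. Qed.

Lemma nsq_ge0 m (x : m.-tuple R) : 0 <= nsq x.
Proof. by apply: sumr_ge0 => i _; exact: sqr_ge0. Qed.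

Lemma nsq_midnorm x :
  nsq x = tnth x ord0 ^+ 2 + midnorm x ^+ 2 + tnth x ord_max ^+ 2.
Proof. by rewrite /nsq sum_mid sqr_midnorm. Qed.

(** Cauchy-Schwarz. With [a] and [b] the two norms, each product satisfies
    [u v <= (b/a) u^2/2 + (a/b) v^2/2], and these bounds sum to [a b]. Zero norms are set apart
    because of the quotients. *)
Lemma sum_mul_le (u v : 'I_n -> R) :
  \sum_(i < n) u i * v i <=
  Num.sqrt (\sum_(i < n) u i ^+ 2) * Num.sqrt (\sum_(i < n) v i ^+ 2).
Proof.
set U := \sum_(i < n) u i ^+ 2; set V := \sum_(i < n) v i ^+ 2.
have U0 : 0 <= U by apply: sumr_ge0 => i _; exact: sqr_ge0.
have V0 : 0 <= V by apply: sumr_ge0 => i _; exact: sqr_ge0.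
have zero (w w' : 'I_n -> R) :
    \sum_(i < n) w i ^+ 2 = 0 -> \sum_(i < n) w i * w' i = 0.
  move=> w0; apply: big1 => i _.
  have /eqP := @psumr_eq0P _ _ _ _ (fun i _ => sqr_ge0 (w i)) w0 i erefl.
  by rewrite sqrf_eq0 => /eqP ->; rewrite mul0r.
have [U00|U00] := eqVneq U 0; first by rewrite zero// U00 sqrtr0 mul0r.
have [V00|V00] := eqVneq V 0.
  under eq_bigr do rewrite mulrC.
  by rewrite zero// V00 sqrtr0 mulr0.
have a0 : 0 < Num.sqrt U by rewrite sqrtr_gt0 lt_neqAle eq_sym U00.
have b0 : 0 < Num.sqrt V by rewrite sqrtr_gt0 lt_neqAle eq_sym V00.
set a := Num.sqrt U in a0 *; set b := Num.sqrt V in b0 *.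
have Ua : U = a ^+ 2 by rewrite sqr_sqrtr.
have Vb : V = b ^+ 2 by rewrite sqr_sqrtr.
have -> : a * b = b / a / 2 * U + a / b / 2 * V.
  by rewrite Ua Vb; field; rewrite !gt_eqF.
rewrite /U /V !mulr_sumr -big_split; apply: ler_sum => i _ /=.
rewrite -subr_ge0 (_ : _ - _ = (b * u i - a * v i) ^+ 2 / (2 * a * b)).
  by rewrite divr_ge0 ?sqr_ge0// !mulr_ge0// ltW.
by field; rewrite !gt_eqF.
Qed.

Lemma midnormD x y z : (forall i, tnth z i = tnth x i + tnth y i) ->
  midnorm z <= midnorm x + midnorm y.
Proof.
move=> zE; rewrite -ler_sqr ?nnegrE ?addr_ge0 ?midnorm_ge0//.
rewrite sqrrD !sqr_midnorm.
under eq_bigr do rewrite zE sqrrD.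
rewrite !big_split /= lerD2r lerD2l mulr2n.
by apply: lerD; exact: sum_mul_le.
Qed.

Lemma midnorm_ext x y : (forall i, i != ord_max -> tnth y i = tnth x i) ->
  midnorm y = midnorm x.
Proof.
by move=> yE; congr Num.sqrt; apply: eq_bigr => i _; rewrite yE ?mid_ord_neq_max.
Qed.

Lemma midnormZ x y (lam : R) : 0 <= lam ->
  (forall i, tnth y i = lam * tnth x i) -> midnorm y = lam * midnorm x.
Proof.
move=> l0 yE; apply/eqP; rewrite -(@eqrXn2 _ 2) ?mulr_ge0 ?midnorm_ge0//.
rewrite exprMn !sqr_midnorm mulr_sumr; apply/eqP/eq_bigr => i _.
by rewrite yE exprMn.
Qed.

(** The angle condition in the half-plane of the first coordinate and [midnorm]. It is linear there,
    so stability under sums follows from the triangle inequality for [midnorm]. *)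
Definition in_cone c s theta := midnorm theta * c <= tnth theta ord0 * s.

Lemma circ_prod_coneP (alpha : R) theta : 0 < alpha < pi / 2 ->
  circ_prod_cone n alpha theta <-> in_cone (cos alpha) (sin alpha) theta.
Proof.
move=> halpha; have [c0 s0 cs] := cos_sin_acute halpha.
have key (x0 p : R) : 0 <= p ->
    (Num.sqrt (x0 ^+ 2 + p ^+ 2) * cos alpha <= x0) <->
    (p * cos alpha <= x0 * sin alpha).
  move=> p0; set u := Num.sqrt _.
  have u0 : 0 <= u by exact: sqrtr_ge0.
  have u2 : u ^+ 2 = x0 ^+ 2 + p ^+ 2 by rewrite sqr_sqrtr// addr_ge0 ?sqr_ge0.
  (* Both inequalities compare nonnegative numbers whose squares have the same difference, so they
     are equivalent. *)
  have E : x0 ^+ 2 - (u * cos alpha) ^+ 2 =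
      (x0 * sin alpha) ^+ 2 - (p * cos alpha) ^+ 2.
    rewrite !exprMn u2 (_ : sin alpha ^+ 2 = 1 - cos alpha ^+ 2); last first.
      by rewrite -cs; ring.
    by ring.
  have uc : 0 <= u * cos alpha by rewrite mulr_ge0// ltW.
  have pc : 0 <= p * cos alpha by rewrite mulr_ge0// ltW.
  split=> h.
    have x00 := le_trans uc h.
    have xs : 0 <= x0 * sin alpha by rewrite mulr_ge0// ltW.
    rewrite -ler_sqr ?nnegrE//.
    by rewrite -subr_ge0 -E subr_ge0 ler_sqr ?nnegrE.
  have xs := le_trans pc h.
  have x00 : 0 <= x0 by rewrite -(pmulr_lge0 _ s0).
  by rewrite -ler_sqr ?nnegrE// -subr_ge0 E subr_ge0 ler_sqr ?nnegrE.
have norm2E (x : n.+1.-tuple R) theta' :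
    (forall i, tnth x i = tnth theta' (widen_ord (leqnSn n.+1) i)) ->
    norm2 x = Num.sqrt (tnth theta' ord0 ^+ 2 + midnorm theta' ^+ 2).
  move=> xE; rewrite /norm2 big_ord_recl xE; congr (Num.sqrt (tnth _ _ ^+ 2 + _)).
    exact/val_inj.
  rewrite sqr_midnorm; apply: eq_bigr => i _; rewrite xE.
  by congr (tnth _ _ ^+ 2); exact/val_inj.
rewrite /circ_prod_cone /prod_line /in_cone -key ?midnorm_ge0//; split.
  move=> [x xK [t _ <-]]; move: xK; rewrite /circ_cone /=.
  set th := [tuple of rcons x t].
  have xE i : tnth x i = tnth th (widen_ord (leqnSn n.+1) i).
    by rewrite !(tnth_nth 0) /= nth_rcons size_tuple ltn_ord.
  rewrite (norm2E _ _ xE) xE.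
  by rewrite (_ : widen_ord _ _ = ord0) //; exact/val_inj.
move=> h; exists [tuple tnth theta (widen_ord (leqnSn n.+1) i) | i < n.+1].
  rewrite /circ_cone /= (norm2E _ theta); last by move=> i; rewrite tnth_mktuple.
  by rewrite tnth_mktuple (_ : widen_ord _ _ = ord0) //; exact/val_inj.
exists (tnth theta ord_max) => //; apply: eq_from_tnth => i.
rewrite (tnth_nth 0) /= nth_rcons size_map size_enum_ord.
have [ilt|] := ltnP i n.+1.
  rewrite (nth_map ord0) ?size_enum_ord//; congr tnth; apply/val_inj => /=.
  by rewrite nth_enum_ord.
move=> ni; have /eqP ein : i == n.+1 :> nat.
  by rewrite eqn_leq ni -ltnS ltn_ord.
by rewrite ein eqxx; congr tnth; apply/val_inj.
Qed.

(** The squared norm of the projection of [y] on the cone. In the half-plane of [(a, r)], a point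
    outside the cone projects on the boundary ray of direction [(c, s)], or on the origin when
    [a c + r s] is negative. *)
Definition glr_val c s y : R :=
  let a := tnth y ord0 in let r := midnorm y in
  (if r * c <= a * s then a ^+ 2 + r ^+ 2
   else Num.max 0 (a * c + r * s) ^+ 2) + tnth y ord_max ^+ 2.

Section angle.
Variables (c s : R).
Hypotheses (c0 : 0 < c) (s0 : 0 < s) (cs : c ^+ 2 + s ^+ 2 = 1).

Let s2E : s ^+ 2 = 1 - c ^+ 2. Proof. by rewrite -cs addrC addKr. Qed.

Let max_sqr (q : R) : Num.max 0 q * q = Num.max 0 q ^+ 2.
Proof. by rewrite expr2; case: (leP 0 q) => // _; rewrite !mul0r. Qed.

(** Since [2 <y, theta> - |theta|^2 = |y|^2 - |y - theta|^2], maximizing it over the cone amounts to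
    projecting [y]. Cauchy-Schwarz on the middle coordinates reduces the bound to the half-plane. *)
Lemma glr_val_ub y theta : in_cone c s theta ->
  2 * dot y theta - nsq theta <= glr_val c s y.
Proof.
rewrite /in_cone /glr_val /dot sum_mid nsq_midnorm => h.
have CS := sum_mul_le (fun i => tnth y (mid_ord i))
  (fun i => tnth theta (mid_ord i)).
rewrite -/(midnorm y) -/(midnorm theta) in CS.
have r0 := midnorm_ge0 y; have p0 := midnorm_ge0 theta.
set M := \sum_(i < n) _ in CS *; set r := midnorm y in CS r0 *.
set p := midnorm theta in CS p0 h *.
set x := tnth theta ord0 in h *; set t := tnth theta _; set a := tnth y ord0.
set b := tnth y _.
have bt : 2 * (b * t) - t ^+ 2 <= b ^+ 2.
  by rewrite -subr_ge0 (_ : _ - _ = (b - t) ^+ 2) ?sqr_ge0//; ring.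
suff : 2 * (a * x + r * p) - (x ^+ 2 + p ^+ 2) <=
  if r * c <= a * s then a ^+ 2 + r ^+ 2 else Num.max 0 (a * c + r * s) ^+ 2.
  by lra.
case: ifPn => [_|].
  rewrite -subr_ge0 (_ : _ - _ = (a - x) ^+ 2 + (r - p) ^+ 2).
    by rewrite addr_ge0 ?sqr_ge0.
  by ring.
rewrite -ltNge => ra.
(* Coordinates of [(x, p)] along the boundary ray and along the inward normal. Membership in the
   cone is [v >= 0], whereas the normal coordinate of [(a, r)] is negative, so [v] can only lower
   the objective. *)
pose u := x * c + p * s; pose v := x * s - p * c.
have v0 : 0 <= v by rewrite subr_ge0.
have x0 : 0 <= x.
  by rewrite -(pmulr_lge0 _ s0); apply: le_trans h; rewrite mulr_ge0// ltW.
have u0 : 0 <= u by rewrite addr_ge0// mulr_ge0// ltW.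
set q := a * c + r * s.
have -> : a * x + r * p = q * u - (r * c - a * s) * v.
  transitivity ((a * x + r * p) * (c ^+ 2 + s ^+ 2)); first by rewrite cs mulr1.
  by rewrite /q /u /v; ring.
have -> : x ^+ 2 + p ^+ 2 = u ^+ 2 + v ^+ 2.
  transitivity ((x ^+ 2 + p ^+ 2) * (c ^+ 2 + s ^+ 2)); first by rewrite cs mulr1.
  by rewrite /u /v; ring.
have rv : 0 <= (r * c - a * s) * v by rewrite mulr_ge0// subr_ge0 ltW.
have qq : q <= Num.max 0 q by rewrite le_max lexx orbT.
have qu : q * u <= Num.max 0 q * u by rewrite ler_wpM2r.
have := sqr_ge0 (Num.max 0 q - u); have := sqr_ge0 v.
rewrite sqrrB mulr2n; lra.
Qed.

Lemma glr_val_attained y :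
  exists2 theta, in_cone c s theta & 2 * dot y theta - nsq theta = glr_val c s y.
Proof.
rewrite /glr_val; case: ifPn => [h|].
  exists y; first exact: h.
  rewrite nsq_midnorm /dot.
  under eq_bigr do rewrite -expr2.
  by rewrite -/(nsq y) nsq_midnorm; ring.
rewrite -ltNge => ra; set r := midnorm y in ra *.
set a := tnth y ord0 in ra *; set b := tnth y ord_max.
set q := Num.max 0 _.
have q0 : 0 <= q by rewrite le_max lexx.
have r0 : 0 <= r := midnorm_ge0 y.
(* Inverting 0 gives 0, so the case [r = 0] has to be checked: there, lying outside the cone means
   [a < 0], whence [q = 0]. *)
have qr : q * (r * r^-1) = q.
  have [r00|r00] := eqVneq r 0; last by rewrite divff// mulr1.
  rewrite r00 mul0r mulr0; apply/esym/max_idPl.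
  rewrite r00 mul0r addr0; move: ra; rewrite r00 mul0r => as0.
  have a00 : a < 0 by rewrite -(pmulr_llt0 _ s0).
  by rewrite ltW// pmulr_llt0.
have assoc1 (A B C D : R) : A * B * D * C = A * (C * D) * B by ring.
(* The projection: [q] times [(c, s)] in the half-plane, the middle coordinates of [y] being
   rescaled to norm [q * s], and the last coordinate kept. *)
pose th (i : 'I_n.+2) : R := if i == ord0 then q * c else
  if i == ord_max then b else q * s / r * tnth y i.
have thm i : th (mid_ord i) = q * s / r * tnth y (mid_ord i).
  by rewrite /th (negbTE (mid_ord_neq0 i)) (negbTE (mid_ord_neq_max i)).
pose theta := [tuple th i | i < n.+2].
have p2 : midnorm theta = q * s.
  apply/eqP; rewrite -(@eqrXn2 _ 2) ?midnorm_ge0 ?mulr_ge0// 1?ltW//.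
  rewrite sqr_midnorm.
  under eq_bigr => i _ do rewrite tnth_mktuple thm exprMn.
  rewrite -mulr_sumr -sqr_midnorm -/r -exprMn.
  by rewrite assoc1 qr.
exists theta.
  by rewrite /in_cone p2 tnth_mktuple /th eqxx mulrAC.
rewrite nsq_midnorm p2 /dot sum_mid !tnth_mktuple.
under eq_bigr => i _ do rewrite tnth_mktuple thm mulrCA -expr2.
rewrite -mulr_sumr -sqr_midnorm -/r -/a -/b /th /= eqxx.
rewrite (_ : q * s / r * r ^+ 2 = q * s * r); last first.
  by rewrite (expr2 r) mulrA (assoc1 q) qr.
have E : q * (a * c + r * s) = q ^+ 2 by rewrite /q max_sqr.
rewrite !exprMn s2E.
have -> : 2 * (a * (q * c) + q * s * r + b * b) =
  2 * (q * (a * c + r * s)) + 2 * b ^+ 2 by ring.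
by rewrite E; ring.
Qed.

(** If [u] is optimal for [g], then [u + theta] lies in the cone and is a competitor for
    [theta + g]; its objective is exactly the left-hand side. *)
Lemma glr_val_cone_add theta g z :
  (forall i, tnth z i = tnth theta i + tnth g i) -> in_cone c s theta ->
  glr_val c s g + nsq theta + 2 * dot theta g <= glr_val c s z.
Proof.
move=> zE thK; have [u uK <-] := glr_val_attained g.
pose w := [tuple tnth u i + tnth theta i | i < n.+2].
have wE i : tnth w i = tnth u i + tnth theta i by rewrite tnth_mktuple.
have wK : in_cone c s w.
  rewrite /in_cone wE mulrDl; apply: le_trans (lerD uK thK).
  by rewrite -mulrDl ler_wpM2r ?(midnormD wE)// ltW.
apply: le_trans (glr_val_ub z wK).
rewrite le_eqVlt; apply/orP; left; apply/eqP.
rewrite /dot /nsq !mulr_sumr -!sumrB -!big_split; apply: eq_bigr => i _ /=.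
by rewrite wE zE; ring.
Qed.

Lemma glr_val_scale (lam : R) x y : 0 < lam ->
  (forall i, tnth y i = lam * tnth x i) ->
  glr_val c s y = lam ^+ 2 * glr_val c s x.
Proof.
move=> l0 yE; rewrite /glr_val (midnormZ (ltW l0) yE) !yE [RHS]mulrDr.
congr (_ + _); last by rewrite exprMn.
rewrite -!(mulrA lam) ler_pM2l//.
case: ifPn => _; first by ring.
have maxE q : Num.max 0 (lam * q) = lam * Num.max 0 q.
  by rewrite maxr_pMr ?mulr0// ltW.
by rewrite -mulrDr maxE; ring.
Qed.

Lemma glr_val_shift_last x y :
  (forall i, i != ord_max -> tnth y i = tnth x i) ->
  glr_val c s y = glr_val c s x - tnth x ord_max ^+ 2 + tnth y ord_max ^+ 2.
Proof.
by move=> yE; rewrite /glr_val (midnorm_ext yE) yE ?ord0_neq_max// addrK.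
Qed.

(** The half-plane contribution differs from [s^2 r^2] by at most [2 a^2 + 2 |a| r], and
    [2 |a| r <= e a^2 + |y|^2 / e]. The parameter [e] will be of order [sqrt d], the size of
    [|y|]. *)
Lemma glr_val_nsq y (e : R) : 0 < e ->
  `|glr_val c s y - s ^+ 2 * nsq y| <=
  (3 + e) * tnth y ord0 ^+ 2 + nsq y / e + tnth y ord_max ^+ 2.
Proof.
move=> e0; rewrite /glr_val nsq_midnorm.
have r0 := midnorm_ge0 y; set r := midnorm y in r0 *.
set a := tnth y ord0; set b := tnth y ord_max.
have s21 : s ^+ 2 <= 1 by rewrite s2E lerBlDr lerDl sqr_ge0.
have s20 := sqr_ge0 s; have a2 := sqr_ge0 a; have b2 := sqr_ge0 b.
have c20 := sqr_ge0 c.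
have c21 : c ^+ 2 <= 1 by rewrite -subr_ge0 -s2E.
have c1 : c <= 1 by rewrite -(@expr_le1 _ 2) ?(ltW c0).
have s1 : s <= 1 by rewrite -(@expr_le1 _ 2) ?(ltW s0).
have aa : `|a| ^+ 2 = a ^+ 2 by rewrite real_normK ?num_real.
have a0 := normr_ge0 a.
have ler : 2 * `|a| * r <= e * a ^+ 2 + (a ^+ 2 + r ^+ 2 + b ^+ 2) / e.
  rewrite -aa -subr_ge0.
  rewrite (_ : _ - _ = (e * `|a| - r) ^+ 2 / e + (`|a| ^+ 2 + b ^+ 2) / e).
    by rewrite addr_ge0 ?divr_ge0 ?addr_ge0 ?sqr_ge0 ?(ltW e0).
  by field; rewrite gt_eqF.
suff : `|(if r * c <= a * s then a ^+ 2 + r ^+ 2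
    else Num.max 0 (a * c + r * s) ^+ 2) - s ^+ 2 * r ^+ 2| <=
    2 * a ^+ 2 + 2 * `|a| * r.
  rewrite !ler_norml; set F := if _ then _ else _ => /andP[h1 h2].
  have sa : s ^+ 2 * a ^+ 2 <= a ^+ 2 by rewrite ler_piMl.
  have sb : s ^+ 2 * b ^+ 2 <= b ^+ 2 by rewrite ler_piMl.
  have sa0 : 0 <= s ^+ 2 * a ^+ 2 by rewrite mulr_ge0.
  have sb0 : 0 <= s ^+ 2 * b ^+ 2 by rewrite mulr_ge0.
  rewrite !mulrDr mulrDl.
  by apply/andP; split; lra.
have ac : `|a * c| <= `|a| by rewrite normrM (gtr0_norm c0) ler_piMr.
rewrite ler_norml; have := ler_norm a; have := ler_norm (- a).
rewrite normrN => na1 na2.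
have ar : 0 <= `|a| * r by rewrite mulr_ge0.
case: ifPn => [h|].
  (* Inside the cone [r^2 c^2 <= a^2 s^2], so [r^2] itself is close to [s^2 r^2]. *)
  have rc : (r * c) ^+ 2 <= (a * s) ^+ 2.
    by rewrite ler_sqr ?nnegrE// ?(le_trans _ h)// mulr_ge0// ltW.
  rewrite !exprMn in rc.
  have r2 : r ^+ 2 = r ^+ 2 * c ^+ 2 + s ^+ 2 * r ^+ 2.
    by rewrite s2E; ring.
  have as2 : a ^+ 2 * s ^+ 2 <= a ^+ 2 by rewrite ler_piMr.
  have r2c : 0 <= r ^+ 2 * c ^+ 2 by rewrite mulr_ge0// sqr_ge0.
  by apply/andP; split; lra.
move=> _; set q := a * c + r * s.
have rs0 : 0 <= r * s by rewrite mulr_ge0// ltW.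
move: ac; rewrite ler_norml => /andP[ac1 ac2].
have rsr : r * s <= r by rewrite ler_piMr.
have acrs : `|a| * (r * s) <= `|a| * r by rewrite ler_wpM2l.
have -> : s ^+ 2 * r ^+ 2 = (r * s) ^+ 2 by rewrite exprMn mulrC.
apply/andP; split.
  (* When [q < 0] the projection vanishes, but then [r s < |a|], so [s^2 r^2] is within the allowed
     error. *)
  have [q0|q0] := leP 0 q; last first.
    have : r * s < `|a| by rewrite /q in q0; lra.
    rewrite expr0n /=; nra.
  have := sqr_ge0 (a * c).
  have -> : q ^+ 2 = (a * c) ^+ 2 + 2 * (a * c) * (r * s) + (r * s) ^+ 2.
    by rewrite /q; ring.
  have : - `|a| * (r * s) <= (a * c) * (r * s) by rewrite ler_wpM2r.
  lra.
have qle : Num.max 0 q <= `|a| + r * s.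
  by rewrite ge_max addr_ge0//= /q lerD2r.
have : Num.max 0 q ^+ 2 <= (`|a| + r * s) ^+ 2.
  by rewrite ler_sqr ?nnegrE ?addr_ge0// le_max lexx.
rewrite sqrrD mulr2n aa; lra.
Qed.

End angle.

Lemma measurable_midnorm : measurable_fun [set: n.+2.-tuple R] midnorm.
Proof.
apply: (@measurableT_comp _ _ _ _ _ _ (@Num.sqrt R)).
  by apply: continuous_measurable_fun; exact: sqrt_continuous.
apply: measurable_sum => i; apply: measurable_funX.
exact: (@measurable_tnth _ R n.+2 (mid_ord i)).
Qed.

Lemma measurable_glr_val c s : measurable_fun [set: n.+2.-tuple R] (glr_val c s).
Proof.
have mr := measurable_midnorm.
have mt i : measurable_fun [set: n.+2.-tuple R] (fun y => tnth y i).
  exact: measurable_tnth.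
apply: measurable_funD; last exact: measurable_funX.
apply: measurable_fun_ifT.
- by apply: measurable_fun_ler; exact: measurable_funM.
- by apply: measurable_funD; exact: measurable_funX.
- apply: measurable_funX; apply: measurable_maxr => //.
  by apply: measurable_funD; exact: measurable_funM.
Qed.

End circular_product_cone.

(** * Probabilities of events *)

Section fine_probability.
Context d (T : measurableType d) (R : realType) (P : probability T R).

Local Notation pr A := (fine (P A)).

Lemma prE A : measurable A -> P A = (pr A)%:E.
Proof. by move=> mA; rewrite fineK// fin_num_measure. Qed.

Lemma pr_le A B : measurable A -> measurable B -> A `<=` B -> pr A <= pr B.
Proof.
by move=> mA mB AB; rewrite -lee_fin -!prE//; apply: le_measure; rewrite ?inE.
Qed.

Lemma prC A : measurable A -> pr (~` A) = 1 - pr A.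
Proof.
move=> mA; apply/EFin_inj; rewrite EFinB -!prE//; last exact: measurableC.
exact: probability_setC.
Qed.

Lemma prU_le A B : measurable A -> measurable B ->
  pr (A `|` B) <= pr A + pr B.
Proof.
move=> mA mB; rewrite -lee_fin EFinD -!prE//; last exact: measurableU.
exact: measureU2.
Qed.

Lemma markov_ge0 (f : T -> R) (a m : R) : measurable_fun [set: T] f ->
  (forall x, 0 <= f x) -> 0 < a -> (\int[P]_x (f x)%:E <= m%:E)%E ->
  pr [set x | a <= f x] <= m / a.
Proof.
move=> mf f0 a0 fm.
set A := [set x | _].
have mA : measurable A.
  rewrite -[X in measurable X]setTI.
  by apply: (measurable_fun_ler (f := fun=> a) (g := f)).
rewrite ler_pdivlMr// -lee_fin; apply: le_trans fm.
rewrite EFinM -prE//.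
have <- : (\int[P]_(x in A) a%:E = P A * a%:E)%E.
  by rewrite integral_cst// muleC.
apply: (@le_trans _ _ (\int[P]_(x in A) (f x)%:E)%E).
  apply: ge0_le_integral => //.
  - by move=> x _; rewrite lee_fin ltW.
  - by apply/measurable_EFinP; exact: measurable_funTS.
apply: ge0_subset_integral => //.
- by apply/measurable_EFinP.
- by move=> x _; rewrite lee_fin.
Qed.

End fine_probability.

Lemma measurable_preimageT d d' (T : measurableType d) (T' : measurableType d')
    (f : T -> T') (B : set T') :
  measurable_fun [set: T] f -> measurable B -> measurable [set x | B (f x)].
Proof. by move=> mf mB; rewrite -[X in measurable X]setTI; exact: mf. Qed.

Section gauss_events.
Context {R : realType}.

Lemma expectation_test n (sigma : R) (theta : n.-tuple R)
    (psi : n.-tuple R -> bool) : measurable_fun [set: n.-tuple R] psi ->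
  ('E_(gauss_law sigma theta)[fun y => (psi y)%:R] =
   (fine (std_gauss n [set g | psi (observation theta sigma g)]))%:E)%E.
Proof.
move=> mpsi; have mA : measurable [set y | psi y].
  by rewrite -[X in measurable X]setTI; exact: mpsi.
have mB : measurable [set g | psi (observation theta sigma g)].
  exact: measurable_preimageT (measurable_observation theta sigma) mA.
rewrite -prE//; transitivity (gauss_law sigma theta [set y | psi y]) => //.
rewrite -(expectation_indic (gauss_law sigma theta) mA).
congr expectation; apply/funext => y; rewrite indicE; congr ((nat_of_bool _)%:R).
by apply/idP/idP; rewrite inE.
Qed.

Lemma expectation_testC n (sigma : R) (theta : n.-tuple R)
    (psi : n.-tuple R -> bool) : measurable_fun [set: n.-tuple R] psi ->
  ('E_(gauss_law sigma theta)[fun y => (1 - (psi y)%:R)%R] =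
   (1 - fine (std_gauss n [set g | psi (observation theta sigma g)]))%:E)%E.
Proof.
move=> mpsi.
have mB : measurable [set g | psi (observation theta sigma g)].
  apply: (measurable_preimageT (B := [set y | psi y])
    (measurable_observation theta sigma)).
  by rewrite -[X in measurable X]setTI; exact: mpsi.
rewrite -prC//.
have -> : (fun y => 1 - (psi y)%:R) = (fun y => (~~ psi y)%:R) :> (n.-tuple R -> R).
  by apply/funext => y; case: (psi y); rewrite ?subrr ?subr0.
rewrite expectation_test; last by apply: measurable_neg.
by congr (fine (std_gauss n _))%:E; apply/seteqP; split => y /= /negP.
Qed.

(* Integrate [1_A <= 1_A L + W], where L is the likelihood ratio. *)
Lemma std_gauss_affine_le n (theta : n.-tuple R) (lam w : R)
    (W : n.-tuple R -> R) (A : set (n.-tuple R)) : 0 < lam ->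
  measurable A -> measurable_fun [set: n.-tuple R] W -> (forall g, 0 <= W g) ->
  (forall g, 1 <= affine_lr theta lam g + W g) ->
  (\int[std_gauss n]_g (W g)%:E <= w%:E)%E ->
  fine (std_gauss n A) <=
  fine (std_gauss n [set g | A (observation theta lam g)]) + w.
Proof.
move=> l0 mA mW W0 LW Ww.
have mB : measurable [set g | A (observation theta lam g)].
  exact: measurable_preimageT (measurable_observation theta lam) mA.
have mi : measurable_fun [set: n.-tuple R] (fun g => (\1_A g : R)%:E).
  by apply/measurable_EFinP; exact: measurable_indic.
have mL : measurable_fun [set: n.-tuple R] (fun g => (affine_lr theta lam g)%:E).
  by apply/measurable_EFinP; exact: measurable_affine_lr.
have mWE : measurable_fun [set: n.-tuple R] (fun g => (W g)%:E).
  exact/measurable_EFinP.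
have i0 g : (0 <= (\1_A g : R)%:E)%E by rewrite lee_fin indicE.
rewrite -lee_fin EFinD -!prE//.
apply: (@le_trans _ _ (std_gauss n [set g | A (observation theta lam g)] +
  \int[std_gauss n]_g (W g)%:E)%E); last by rewrite leeD2l.
have -> : std_gauss n [set g | A (observation theta lam g)] =
    (\int[std_gauss n]_g ((\1_A g : R)%:E * (affine_lr theta lam g)%:E))%E.
  rewrite -(ge0_integral_std_gauss_affine theta l0 mi i0).
  by rewrite -[X in std_gauss n X]setIT -integral_indic.
rewrite -ge0_integralD//; first last.
- by move=> g _; rewrite lee_fin.
- exact: emeasurable_funM.
- by move=> g _; rewrite mule_ge0// lee_fin affine_lr_ge0.
rewrite -[X in (std_gauss n X <= _)%E]setIT -integral_indic//.
apply: ge0_le_integral => //.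
- by apply: emeasurable_funD => //; exact: emeasurable_funM.
- move=> g _; rewrite -EFinM -EFinD lee_fin indicE.
  by case: (_ \in _); rewrite ?mul1r ?mul0r ?add0r.
Qed.

(** The preceding bound applied to the complement of [A]. *)
Lemma std_gauss_affine_ge n (theta : n.-tuple R) (lam w : R)
    (W : n.-tuple R -> R) (A : set (n.-tuple R)) : 0 < lam ->
  measurable A -> measurable_fun [set: n.-tuple R] W -> (forall g, 0 <= W g) ->
  (forall g, 1 <= affine_lr theta lam g + W g) ->
  (\int[std_gauss n]_g (W g)%:E <= w%:E)%E ->
  fine (std_gauss n [set g | A (observation theta lam g)]) <=
  fine (std_gauss n A) + w.
Proof.
move=> l0 mA mW W0 LW Ww.
have mB := measurable_preimageT (measurable_observation theta lam) mA.
have := std_gauss_affine_le l0 (measurableC mA) mW W0 LW Ww.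
rewrite (prC _ mA) (prC _ mB); lra.
Qed.

End gauss_events.

(** * Gaussian densities, uniform error and testing radii for the null [{0}] *)

Section testing_radii.
Context {R : realType}.

Lemma sum_sqr_sub m (y theta : m.-tuple R) :
  \sum_(i < m) (tnth y i - tnth theta i) ^+ 2 =
  nsq y - (2 * dot y theta - nsq theta).
Proof.
rewrite /dot /nsq mulr_sumr -!sumrB; apply: eq_bigr => i _; ring.
Qed.

(** Written so that [theta] enters only through [2 * dot y theta - nsq theta], the quantity
    maximized by [glr_val]. *)
Lemma gauss_pdfE m (sigma : R) (theta y : m.-tuple R) : 0 < sigma ->
  gauss_pdf sigma theta y = normal_peak sigma ^+ m *
    expR ((2 * dot y theta - nsq theta - nsq y) / (sigma ^+ 2 *+ 2)).
Proof.
move=> s0; rewrite /gauss_pdf.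
under eq_bigr => i _ do rewrite normal_pdfE ?gt_eqF//.
rewrite big_split /= prodr_const card_ord; congr (_ * _).
rewrite /normal_fun -expR_sum -mulr_suml sumrN sum_sqr_sub.
by rewrite opprB.
Qed.

Lemma norm2_vsub0 m (theta : m.-tuple R) :
  norm2 (vsub theta (vzero m)) = Num.sqrt (nsq theta).
Proof.
congr Num.sqrt; apply: eq_bigr => i _.
by rewrite !tnth_mktuple subr0.
Qed.

Lemma notin_neighborhood2 m (theta : m.-tuple R) (e : R) :
  ~ neighborhood2 [set vzero m] e theta <-> e < Num.sqrt (nsq theta).
Proof.
rewrite /neighborhood2 /= image_set1 ereal_inf1 norm2_vsub0 lee_fin.
by rewrite ltNge; split => [/negP|] // /negP.
Qed.

Lemma uniform_error_le m (sigma : R) (C2 : set (m.-tuple R))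
    (psi : m.-tuple R -> bool) (e a b : R) :
  measurable_fun [set: m.-tuple R] psi ->
  fine (std_gauss m [set g | psi (observation (vzero m) sigma g)]) <= a ->
  (forall theta, C2 theta -> e < Num.sqrt (nsq theta) ->
    1 - fine (std_gauss m [set g | psi (observation theta sigma g)]) <= b) ->
  (uniform_error sigma [set vzero m] C2 psi e <= (a + b)%:E)%E.
Proof.
move=> mpsi null alt; rewrite /uniform_error EFinD; apply: leeD.
  by rewrite image_set1 ereal_sup1 expectation_test// lee_fin.
apply: ge_ereal_sup => _ [theta [C2t /notin_neighborhood2 et] <-].
by rewrite expectation_testC// lee_fin; exact: alt.
Qed.

Lemma uniform_error_ge m (sigma : R) (C2 : set (m.-tuple R))
    (psi : m.-tuple R -> bool) (e : R) theta :
  measurable_fun [set: m.-tuple R] psi ->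
  C2 theta -> e < Num.sqrt (nsq theta) ->
  ((fine (std_gauss m [set g | psi (observation (vzero m) sigma g)]) +
    (1 - fine (std_gauss m [set g | psi (observation theta sigma g)])))%:E <=
   uniform_error sigma [set vzero m] C2 psi e)%E.
Proof.
move=> mpsi C2t et; rewrite /uniform_error EFinD; apply: leeD.
  by rewrite image_set1 ereal_sup1 expectation_test.
apply: ereal_sup_ubound; exists theta; last by rewrite expectation_testC.
by split => //; apply/notin_neighborhood2.
Qed.

(** [E eps] stands for the set of errors at radius [eps] over a class of tests, so this lemma and
    the next serve both radii. *)
Lemma testing_radius_le (E : R -> set \bar R) (rho e : R) (x : \bar R) :
  0 < e -> E e x -> (x <= rho%:E)%E ->
  (ereal_inf [set eps%:E | eps in [set eps : R |
     (0 < eps)%R /\ (ereal_inf (E eps) <= rho%:E)%E]] <= e%:E)%E.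
Proof.
move=> e0 Ex xr; apply: ereal_inf_lbound; exists e => //; split => //.
by apply: le_trans xr; exact: ereal_inf_lbound.
Qed.

Lemma testing_radius_ge (E : R -> set \bar R) (rho eta e : R) :
  rho < eta ->
  (forall eps x, 0 < eps < e -> E eps x -> (eta%:E <= x)%E) ->
  (e%:E <= ereal_inf [set eps%:E | eps in [set eps : R |
     (0 < eps)%R /\ (ereal_inf (E eps) <= rho%:E)%E]])%E.
Proof.
move=> re h; apply: le_ereal_inf_tmp => _ [eps [eps0 Er] <-].
rewrite lee_fin leNgt; apply/negP => epse.
have : (eta%:E <= ereal_inf (E eps))%E.
  by apply: le_ereal_inf_tmp => x; apply: h; rewrite eps0.
by move=> /le_trans /(_ Er); rewrite lee_fin leNgt re.
Qed.

End testing_radii.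

(** * Closed form of the GLR statistic *)

Section glr_circ.
Context {R : realType} {n : nat}.
Variables (alpha sigma : R).
Hypotheses (halpha : 0 < alpha < pi / 2) (sigma0 : 0 < sigma).

(** The peaks and the factors [e^(-|y|^2 / (2 sigma^2))] cancel in the likelihood ratio, which
    leaves [e^(-v / (2 sigma^2))]. *)
Lemma glr_statisticE (y : n.+2.-tuple R) :
  glr_statistic sigma [set vzero n.+2] (circ_prod_cone n alpha) y =
  glr_val (cos alpha) (sin alpha) y / sigma ^+ 2.
Proof.
have [c0 s0 cs] := cos_sin_acute halpha.
set c := cos alpha in c0 cs *; set s := sin alpha in s0 cs *.
pose pk : R := normal_peak sigma ^+ n.+2.
have pk0 : 0 < pk by rewrite exprn_gt0// normal_peak_gt0 ?gt_eqF.
have s2 : 0 < sigma ^+ 2 *+ 2 by rewrite pmulrn_lgt0// exprn_gt0.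
pose v := glr_val c s y.
have sup2 : sup [set gauss_pdf sigma theta y | theta in circ_prod_cone n alpha] =
    pk * expR ((v - nsq y) / (sigma ^+ 2 *+ 2)).
  apply/eqP; rewrite eq_le; apply/andP; split.
    apply: ge_sup.
      have [theta thK _] := glr_val_attained c0 s0 cs y.
      by exists (gauss_pdf sigma theta y), theta => //; exact/circ_prod_coneP.
    move=> _ [theta /(circ_prod_coneP _ halpha) thK <-].
    rewrite gauss_pdfE// ler_pM2l// ler_expR ler_pM2r ?invr_gt0// lerD2r.
    exact: glr_val_ub.
  apply: ub_le_sup.
    exists (pk * expR ((v - nsq y) / (sigma ^+ 2 *+ 2))).
    move=> _ [theta /(circ_prod_coneP _ halpha) thK <-].
    rewrite gauss_pdfE// ler_pM2l// ler_expR ler_pM2r ?invr_gt0// lerD2r.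
    exact: glr_val_ub.
  have [theta thK thE] := glr_val_attained c0 s0 cs y.
  exists theta; first exact/circ_prod_coneP.
  by rewrite gauss_pdfE// thE.
have sup1E : sup [set gauss_pdf sigma theta y | theta in [set vzero n.+2]] =
    pk * expR (- nsq y / (sigma ^+ 2 *+ 2)).
  rewrite image_set1 sup1 gauss_pdfE//.
  have -> : dot y (vzero n.+2) = 0.
    by apply: big1 => i _; rewrite tnth_mktuple mulr0.
  have -> : nsq (vzero n.+2) = 0 :> R.
    by apply: big1 => i _; rewrite tnth_mktuple expr0n.
  by rewrite mulr0 subrr sub0r.
rewrite /glr_statistic sup1E sup2 -mulf_div divff ?gt_eqF// mul1r.
rewrite -expRN -expRD expRK -/v mulr2n; field.
by rewrite gt_eqF.
Qed.

Lemma measurable_glr_test (beta : R) : measurable_fun [set: n.+2.-tuple R]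
  (glr_test sigma [set vzero n.+2] (circ_prod_cone n alpha) beta).
Proof.
apply: measurable_fun_ler => //.
rewrite (_ : glr_statistic _ _ _ =
  fun y => glr_val (cos alpha) (sin alpha) y / sigma ^+ 2).
  by apply: measurable_funM => //; exact: measurable_glr_val.
by apply/funext => y; exact: glr_statisticE.
Qed.

(** Reduction to unit noise: the observation is [sigma (theta / sigma + g)] and [glr_val] is
    homogeneous of degree 2. *)
Lemma glr_test_obs (beta : R) (theta g : n.+2.-tuple R) :
  glr_test sigma [set vzero n.+2] (circ_prod_cone n alpha) beta
    (observation theta sigma g) =
  (beta <= glr_val (cos alpha) (sin alpha)
    (observation [tuple tnth theta i / sigma | i < n.+2] 1 g)).
Proof.
have [c0 s0 cs] := cos_sin_acute halpha.
rewrite /glr_test glr_statisticE; congr (_ <= _).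
rewrite (glr_val_scale _ _ sigma0 (x := observation
  [tuple tnth theta i / sigma | i < n.+2] 1 g)).
  by rewrite mulrAC divff ?mul1r// gt_eqF// exprn_gt0.
by move=> i; rewrite !tnth_mktuple; field; rewrite gt_eqF.
Qed.

End glr_circ.

(** * Concentration of the GLR statistic *)

Section gauss_deviations.
Context {R : realType} {m : nat}.
Implicit Types (theta g : m.-tuple R).

Local Notation pr A := (fine (std_gauss m A)).

Definition basis_vec (i : 'I_m) (t : R) : m.-tuple R :=
  [tuple if j == i then t else 0 | j < m].

Lemma dot_basis_vec i t g : dot (basis_vec i t) g = t * tnth g i.
Proof.
rewrite /dot (bigD1 i)//= tnth_mktuple eqxx big1 ?addr0// => j ji.
by rewrite tnth_mktuple (negbTE ji) mul0r.
Qed.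

Lemma nsq_basis_vec i (t : R) : nsq (basis_vec i t) = t ^+ 2.
Proof.
rewrite /nsq (bigD1 i)//= tnth_mktuple eqxx big1 ?addr0// => j ji.
by rewrite tnth_mktuple (negbTE ji) expr0n.
Qed.

Lemma measurable_nsq : measurable_fun [set: m.-tuple R] (@nsq R m).
Proof.
apply: (@measurable_sum_tnth R m (fun i x => x ^+ 2)) => i.
exact: exprn_measurable.
Qed.

Lemma measurable_dot theta : measurable_fun [set: m.-tuple R] (dot theta).
Proof.
by apply: (@measurable_sum_tnth R m (fun i x => tnth theta i * x)) => i;
  exact: measurable_funM.
Qed.

Lemma integral_sqr_coord i :
  (\int[std_gauss m]_g ((tnth g i : R) ^+ 2)%:E = 1)%E.
Proof.
have := integral_std_gauss_dot (basis_vec i 1).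
rewrite -/(nsq _) nsq_basis_vec expr1n => <-.
by apply: eq_integral => g _; rewrite -/(dot _ _) dot_basis_vec mul1r.
Qed.

Lemma ge0_integral_affine_fun (f : m.-tuple R -> R) (a b e : R) :
  measurable_fun [set: m.-tuple R] f -> (forall g, 0 <= f g) ->
  0 <= a -> 0 <= b -> (\int[std_gauss m]_g (f g)%:E = e%:E)%E ->
  (\int[std_gauss m]_g (a + b * f g)%:E = (a + b * e)%:E)%E.
Proof.
move=> mf f0 a0 b0 fe.
have mbf : measurable_fun [set: m.-tuple R] (fun g => (b * f g)%:E).
  by apply/measurable_EFinP; exact: measurable_funM.
under eq_integral do rewrite EFinD.
rewrite ge0_integralD//; last by move=> g _; rewrite lee_fin mulr_ge0.
rewrite integral_cst//= probability_setT mule1 EFinD; congr (_ + _)%E.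
under eq_integral do rewrite EFinM.
rewrite ge0_integralZl_EFin ?fe//.
- by move=> g _; rewrite lee_fin.
- exact/measurable_EFinP.
Qed.

Lemma pr_coord_ge i (a : R) : 0 < a -> pr [set g | a <= tnth g i ^+ 2] <= 1 / a.
Proof.
move=> a0; apply: markov_ge0 => //.
- by apply: measurable_funX; exact: measurable_tnth.
- by move=> g; exact: sqr_ge0.
- by rewrite integral_sqr_coord.
Qed.

Lemma pr_dot_ge theta (a : R) : 0 < a ->
  pr [set g | a <= dot theta g ^+ 2] <= nsq theta / a.
Proof.
move=> a0; apply: markov_ge0 => //.
- by apply: measurable_funX; exact: measurable_dot.
- by move=> g; exact: sqr_ge0.
- by rewrite integral_std_gauss_dot.
Qed.

Lemma nsqB g : nsq g - m%:R = \sum_(i < m) (tnth g i ^+ 2 - 1).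
Proof. by rewrite sumrB sumr_const card_ord. Qed.

Lemma pr_nsq_ge (a : R) : 0 < a ->
  pr [set g | a <= (nsq g - m%:R) ^+ 2] <= normal_kurt *+ m / a.
Proof.
move=> a0; apply: markov_ge0 => //.
- by apply: measurable_funX; apply: measurable_funB => //; exact: measurable_nsq.
- by move=> g; exact: sqr_ge0.
- by rewrite -integral_std_gauss_chi2; under eq_integral do rewrite nsqB.
Qed.

Lemma measurable_ge_set (f : m.-tuple R -> R) a :
  measurable_fun [set: m.-tuple R] f -> measurable [set g | a <= f g].
Proof.
move=> mf; rewrite -[X in measurable X]setTI.
by apply: (measurable_fun_ler (f := fun=> a) (g := f)).
Qed.

End gauss_deviations.

Section glr_concentration.
Context {R : realType} {n : nat}.
Variables (c s : R).
Hypotheses (c0 : 0 < c) (s0 : 0 < s) (cs : c ^+ 2 + s ^+ 2 = 1).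
Local Notation dim := (n.+2%:R : R).
Local Notation w := (Num.sqrt dim).
Local Notation pr A := (fine (std_gauss n.+2 A)).

Lemma sqr_sqrt_dim : w ^+ 2 = dim.
Proof. by rewrite sqr_sqrtr. Qed.

Lemma sqrt_dim_ge1 : 1 <= w.
Proof. by rewrite -[leLHS]sqrtr1 ler_sqrt// ler1n. Qed.

Definition atypical (A : R) : set (n.+2.-tuple R) :=
  [set g | A <= tnth g ord0 ^+ 2] `|` [set g | A <= tnth g ord_max ^+ 2] `|`
  [set g | A ^+ 2 * dim <= (nsq g - dim) ^+ 2].

Lemma measurable_atypical A : measurable (atypical A).
Proof.
apply: measurableU; first apply: measurableU.
- apply: measurable_ge_set; apply: measurable_funX.
  exact: (@measurable_tnth _ R n.+2 ord0).
- apply: measurable_ge_set; apply: measurable_funX.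
  exact: (@measurable_tnth _ R n.+2 ord_max).
- apply: measurable_ge_set; apply: measurable_funX; apply: measurable_funB => //.
  exact: measurable_nsq.
Qed.

(** Chebyshev for each of the three events: [1 / A] for each coordinate, and
    [normal_kurt / A^2 <= normal_kurt / A] for the squared norm. The bound is uniform in the
    dimension. *)
Lemma pr_atypical A : 1 <= A -> pr (atypical A) <= (normal_kurt + 2) / A.
Proof.
move=> A1; have A0 : 0 < A by rewrite (lt_le_trans _ A1).
have d0 : 0 < dim by rewrite ltr0n.
have AD0 : 0 < A ^+ 2 * dim by rewrite mulr_gt0// exprn_gt0.
have mc i : measurable [set g : n.+2.-tuple R | A <= tnth g i ^+ 2].
  by apply: measurable_ge_set; apply: measurable_funX; exact: measurable_tnth.
have mn : measurable [set g : n.+2.-tuple R | A ^+ 2 * dim <= (nsq g - dim) ^+ 2].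
  apply: measurable_ge_set; apply: measurable_funX; apply: measurable_funB => //.
  exact: measurable_nsq.
apply: le_trans (prU_le _ _ mn) _; first exact: measurableU.
have h1 := prU_le (std_gauss n.+2) (mc ord0) (mc ord_max).
have h2 := @pr_coord_ge R n.+2 ord0 A A0.
have h3 := @pr_coord_ge R n.+2 ord_max A A0.
have h4 := @pr_nsq_ge R n.+2 _ AD0.
have k0 := @normal_kurt_ge0 R.
have h5 : normal_kurt *+ n.+2 / (A ^+ 2 * dim) <= normal_kurt / A.
  rewrite -mulr_natr (_ : _ / _ = normal_kurt / A ^+ 2); last first.
    by field; rewrite !gt_eqF.
  rewrite ler_wpM2l// lef_pV2 ?posrE ?exprn_gt0//.
  by rewrite expr2 ler_peMl// ltW.
have -> : (normal_kurt + 2) / A = 1 / A + 1 / A + normal_kurt / A.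
  by field; rewrite gt_eqF.
exact: (lerD (le_trans h1 (lerD h2 h3)) (le_trans h4 h5)).
Qed.

(** This is [glr_val_nsq] with [e = sqrt D]. In units of [A sqrt D], the term in the first
    coordinate costs [3 + 1], [nsq g / e] costs 2, the last coordinate 1, and replacing [nsq g] by
    [D] costs 1, in total 8. *)
Lemma glr_val_near A D (g : n.+2.-tuple R) : 1 <= A -> 1 <= D ->
  tnth g ord0 ^+ 2 < A -> tnth g ord_max ^+ 2 < A ->
  (nsq g - D) ^+ 2 < A ^+ 2 * D ->
  `|glr_val c s g - s ^+ 2 * D| <= 8 * A * Num.sqrt D.
Proof.
move=> A1 D1 na nb nS; have A0 : 0 < A by rewrite (lt_le_trans _ A1).
have w1 : 1 <= Num.sqrt D by rewrite -[leLHS]sqrtr1 ler_wsqrtr.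
have w0 : 0 < Num.sqrt D by rewrite (lt_le_trans _ w1).
have w2 : Num.sqrt D ^+ 2 = D by rewrite sqr_sqrtr// (le_trans _ D1).
set w := Num.sqrt D in w0 w1 w2 *.
have {nS} : `|nsq g - D| < A * w.
  rewrite -ltr_sqr ?nnegrE ?mulr_ge0 ?(ltW A0) ?(ltW w0)//.
  by rewrite exprMn w2 real_normK ?num_real.
have := glr_val_nsq c0 s0 cs g w0; set v := glr_val c s g; set N := nsq g.
have s21 : s ^+ 2 <= 1 by rewrite -cs lerDr sqr_ge0.
have s20 := sqr_ge0 s.
rewrite !(ler_norml, ltr_norml) => /andP[v1 v2] /andP[S1 S2].
have Nw : N / w <= w + A.
  rewrite ler_pdivrMr// mulrDl -expr2 w2; lra.
have Aw : A <= A * w by rewrite ler_peMr// ltW.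
have wA : w <= A * w by rewrite ler_peMl// ltW.
have waw : w * tnth g ord0 ^+ 2 <= A * w.
  by rewrite mulrC ler_wpM2r// ltW.
have ss1 : s ^+ 2 * (N - D) <= A * w.
  have [h|h] := leP 0 (N - D).
    by apply: le_trans (ltW S2); rewrite ler_piMl.
  by apply: (@le_trans _ _ 0); [rewrite mulr_ge0_le0// ltW|lra].
have ss2 : - (A * w) <= s ^+ 2 * (N - D).
  have [h|h] := leP 0 (N - D).
    by apply: (@le_trans _ _ 0); [lra|rewrite mulr_ge0].
  apply: le_trans (ltW S1) _.
  by rewrite -subr_ge0 (_ : _ - _ = (1 - s ^+ 2) * - (N - D));
    [rewrite mulr_ge0 ?subr_ge0// oppr_ge0 ltW|ring].
rewrite mulrBr in ss1 ss2; rewrite mulrDl in v1 v2.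
by apply/andP; split; lra.
Qed.

Lemma glr_val_typical A (g : n.+2.-tuple R) : 1 <= A -> ~ atypical A g ->
  `|glr_val c s g - s ^+ 2 * dim| <= 8 * A * w.
Proof.
by move=> A1 ng; apply: glr_val_near; rewrite ?ler1n// ltNge; apply/negP => h;
  apply: ng; [left; left|left; right|right].
Qed.

End glr_concentration.

(** * Radius of the optimal test *)

Section optimal_radius.
Context {R : realType} {n : nat}.
Variables (alpha sigma : R).
Hypotheses (halpha : 0 < alpha < pi / 2) (sigma0 : 0 < sigma).
Local Notation c := (cos alpha).
Local Notation s := (sin alpha).
Local Notation pr A := (fine (std_gauss n.+2 A)).
Local Notation K := (circ_prod_cone n alpha).

(** Squaring the cone condition bounds the middle coordinates by the first one. Hence a fixed share
    [c^2] of the squared norm of any signal sits in two coordinates, whatever the dimension. *)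
Lemma in_cone_nsq_le (theta : n.+2.-tuple R) : in_cone c s theta ->
  0 <= tnth theta ord0 /\
  c ^+ 2 * nsq theta <= tnth theta ord0 ^+ 2 + tnth theta ord_max ^+ 2.
Proof.
have [c0 s0 cs] := cos_sin_acute halpha; rewrite /in_cone => h.
have p0 : 0 <= midnorm theta * c by rewrite mulr_ge0 ?midnorm_ge0// ltW.
have xs := le_trans p0 h; rewrite (pmulr_lge0 _ s0) in xs.
split=> //; rewrite nsq_midnorm.
have : (midnorm theta * c) ^+ 2 <= (tnth theta ord0 * s) ^+ 2.
  by rewrite ler_sqr ?nnegrE// (le_trans p0).
rewrite !exprMn; set x := tnth theta ord0 ^+ 2; set p := midnorm theta ^+ 2.
set t := tnth theta ord_max ^+ 2 => h'.
have c1 : c ^+ 2 * t <= t.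
  by rewrite ler_piMl ?sqr_ge0// -cs lerDl sqr_ge0.
have xE : x = c ^+ 2 * x + x * s ^+ 2 by rewrite (mulrC x) -mulrDl cs mul1r.
by rewrite !mulrDr lerD// [leRHS]xE lerD2l mulrC.
Qed.

Lemma eps_OPT_le (rho : R) : 0 < rho ->
  (eps_OPT sigma [set vzero n.+2] K rho <=
   (sigma * Num.sqrt (32 / (rho * c ^+ 2)))%:E)%E.
Proof.
move=> r0; have [c0 s0 cs] := cos_sin_acute halpha.
have e0 : 0 < 32 / (rho * c ^+ 2) by rewrite divr_gt0// mulr_gt0// exprn_gt0.
set e := Num.sqrt _.
have ee : e ^+ 2 = 32 / (rho * c ^+ 2) by rewrite sqr_sqrtr// ltW.
have {}e0 : 0 < e by rewrite sqrtr_gt0.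
(* By Chebyshev each coordinate of the noise exceeds [a] in absolute value with probability at most
   [rho / 4]; the event [prU] thus costs [rho / 2], and it covers each type of error once. *)
pose a := Num.sqrt (4 / rho).
have a2 : a ^+ 2 = 4 / rho by rewrite sqr_sqrtr// divr_ge0// ltW.
have a0 : 0 < a by rewrite sqrtr_gt0 divr_gt0.
have a20 : 0 < a ^+ 2 by rewrite exprn_gt0.
(* One-sided in the first coordinate, which is nonnegative on the cone, and two-sided in the last
   one. *)
pose psi (y : n.+2.-tuple R) :=
  (a * sigma <= tnth y ord0) || ((a * sigma) ^+ 2 <= tnth y ord_max ^+ 2).
have mpsi : measurable_fun [set: n.+2.-tuple R] psi.
  apply: measurable_or; apply: measurable_fun_ler => //.
    exact: measurable_tnth.
  by apply: measurable_funX; exact: measurable_tnth.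
have mU i : measurable [set g : n.+2.-tuple R | a ^+ 2 <= tnth g i ^+ 2].
  by apply: measurable_ge_set; apply: measurable_funX; exact: measurable_tnth.
have prU : pr ([set g | a ^+ 2 <= tnth g ord0 ^+ 2] `|`
    [set g | a ^+ 2 <= tnth g ord_max ^+ 2]) <= rho / 2.
  have h1 := @pr_coord_ge R n.+2 ord0 _ a20.
  have h2 := @pr_coord_ge R n.+2 ord_max _ a20.
  apply: le_trans (le_trans (prU_le _ (mU ord0) (mU ord_max)) (lerD h1 h2)) _.
  by rewrite a2 le_eqVlt; apply/orP; left; apply/eqP; field; rewrite gt_eqF.
have mpsi_obs theta : measurable [set g | psi (observation theta sigma g)].
  apply: (measurable_preimageT (B := [set y | psi y])
    (measurable_observation theta sigma)).
  by rewrite -[X in measurable X]setTI; exact: mpsi.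
have mUU := measurableU _ _ (mU ord0) (mU ord_max).
have as0 : 0 < a * sigma by rewrite mulr_gt0.
apply: (@testing_radius_le R (fun eps =>
    [set uniform_error sigma [set vzero n.+2] K psi eps |
       psi in [set psi | measurable_fun [set: n.+2.-tuple R] psi]]) rho _
  (uniform_error sigma [set vzero n.+2] K psi (sigma * e))).
- by rewrite mulr_gt0.
- by exists psi.
rewrite (_ : rho = rho / 2 + rho / 2); last by field.
apply: (uniform_error_le mpsi).
  apply: le_trans prU; apply: (pr_le _ (mpsi_obs _) mUU) => g /=.
  rewrite /psi !tnth_mktuple !add0r.
  move=> /orP[h|h]; [left|right].
    move: h; rewrite mulrC ler_pM2l// => h.
    by rewrite ler_sqr ?nnegrE ?(ltW a0)// (le_trans _ h)// ltW.
  by move: h; rewrite !exprMn mulrC ler_pM2l// exprn_gt0.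
move=> theta /(circ_prod_coneP _ halpha)/in_cone_nsq_le [x0 hx] et.
rewrite -(prC _ (mpsi_obs theta)); apply: le_trans prU.
apply: (pr_le _ (measurableC (mpsi_obs theta)) mUU) => g /= /negP.
rewrite /psi negb_or -!ltNge !tnth_mktuple.
have {et} : (sigma * e) ^+ 2 < nsq theta.
  rewrite -[ltRHS]sqr_sqrtr ?nsq_ge0// ltr_sqr ?nnegrE ?sqrtr_ge0//.
  by rewrite mulr_ge0// ltW.
rewrite exprMn ee -(ltr_pM2l (_ : 0 < c ^+ 2)) ?exprn_gt0// => /lt_le_trans /(_ hx).
rewrite (_ : c ^+ 2 * _ = 8 * (a * sigma) ^+ 2); last first.
  by rewrite exprMn a2; field; rewrite !gt_eqF.
set x := tnth theta ord0 in x0 *; set t := tnth theta ord_max.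
set g0 := tnth g ord0; set gl := tnth g ord_max => big /andP[h1 h2].
(* The squares of the two coordinates sum to more than [8 (a sigma)^2], so one coordinate exceeds
   [2 a sigma] in absolute value; missing it requires a noise above [a] there. *)
have [tle|tgt] := leP (t ^+ 2) (4 * (a * sigma) ^+ 2).
  left; rewrite /=.
  have x2 : 2 * (a * sigma) < x.
    have h3 : (2 * (a * sigma)) ^+ 2 < x ^+ 2.
      rewrite (exprMn 2); have -> : 2 ^+ 2 = 4 :> R by ring.
      lra.
    by rewrite -ltr_sqr ?nnegrE// mulr_ge0// ltW.
  have : a * sigma < sigma * - g0 by lra.
  rewrite mulrC ltr_pM2l// => h; rewrite -(sqrrN g0).
  by rewrite ler_sqr ?nnegrE ?(ltW h)// ltW// (lt_trans a0).
right; rewrite /=.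
have h3 : `|t + sigma * gl| < a * sigma.
  by rewrite -ltr_sqr ?nnegrE// ?real_normK ?num_real// ltW.
have h4 : 2 * (a * sigma) < `|t|.
  have as2 : 0 <= 2 * (a * sigma) by rewrite mulr_ge0// ltW.
  rewrite -ltr_sqr ?nnegrE// real_normK ?num_real// (exprMn 2).
  by have -> : 2 ^+ 2 = 4 :> R by ring.
have h5 : `|t| <= `|t + sigma * gl| + `|sigma * gl|.
  by rewrite -{1}(addrK (sigma * gl) t) ler_normB.
have : a * sigma < `|sigma * gl| by lra.
rewrite normrM (gtr0_norm sigma0) mulrC ltr_pM2l// => h6.
by rewrite -[leRHS]real_normK ?num_real// ler_sqr ?nnegrE// ltW.
Qed.

Lemma basis_vec_cone i (t : R) : 0 <= t -> i = ord0 \/ i = ord_max ->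
  K (basis_vec i t).
Proof.
move=> t0 hi; apply/(circ_prod_coneP _ halpha).
have [c0 s0 cs] := cos_sin_acute halpha.
rewrite /in_cone (_ : midnorm _ = 0).
  by rewrite mul0r mulr_ge0 ?(ltW s0)// tnth_mktuple; case: ifP.
rewrite /midnorm big1 ?sqrtr0// => j _; rewrite tnth_mktuple ifF ?expr0n//.
by case: hi => ->; apply/negbTE; [exact: mid_ord_neq0|exact: mid_ord_neq_max].
Qed.

Lemma uniform_error_ge_small_radius (psi : n.+2.-tuple R -> bool) (eps : R) :
  measurable_fun [set: n.+2.-tuple R] psi -> eps < sigma / 2 ->
  ((3 / 8)%:E <= uniform_error sigma [set vzero n.+2] K psi eps)%E.
Proof.
move=> mpsi epss; pose theta : n.+2.-tuple R := basis_vec ord0 (sigma / 2).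
pose u : n.+2.-tuple R := basis_vec ord0 (1 / 2).
have sig2 : 0 < sigma / 2 by rewrite divr_gt0.
have thK : K theta by apply: basis_vec_cone; [exact: ltW|left].
have ntheta : eps < Num.sqrt (nsq theta).
  by rewrite nsq_basis_vec sqrtr_sqr gtr0_norm.
have lower := uniform_error_ge sigma mpsi thK ntheta.
apply: (le_trans _ lower) => {lower}.
have mpsi_obs th : measurable [set g | psi (observation th sigma g)].
  apply: (measurable_preimageT (B := [set y | psi y])
    (measurable_observation th sigma)).
  by rewrite -[X in measurable X]setTI; exact: mpsi.
(* The likelihood ratio is [e^(x/2 - 1/8) >= 7/8 + x/2], and [W] completes [7/8 + x/2 - 1] to the
   square [((x + 1)/2)^2]. Its mean is [5/8], which leaves an error of at least [3/8]. *)
pose W (g : n.+2.-tuple R) : R := 3 / 8 + 1 / 4 * tnth g ord0 ^+ 2.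
have mx : measurable_fun [set: n.+2.-tuple R] (fun g => tnth g ord0 ^+ 2).
  by apply: measurable_funX; exact: measurable_tnth.
have mW : measurable_fun [set: n.+2.-tuple R] W.
  by apply: measurable_funD => //; exact: measurable_funM.
have W0 g : 0 <= W g by rewrite addr_ge0// mulr_ge0// sqr_ge0.
have LW g : 1 <= affine_lr u 1 g + W g.
  rewrite /affine_lr (bigD1 ord0)//= big1 => [|i i0]; last first.
    rewrite tnth_mktuple (negbTE i0) /affine_ratio invr1 mul1r subr0 mulr1.
    by rewrite subrr expR0.
  rewrite tnth_mktuple eqxx mulr1 /affine_ratio invr1 mul1r mulr1 /W.
  set x := tnth g ord0.
  have h1 := expR_ge1Dx (x ^+ 2 / 2 - (x - 1 / 2) ^+ 2 / 2).
  apply: le_trans (lerD h1 (lexx _)).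
  rewrite -subr_ge0 (_ : _ - _ = ((x + 1) / 2) ^+ 2) ?sqr_ge0//.
  by field.
have intW : (\int[std_gauss n.+2]_g (W g)%:E <= (5 / 8)%:E)%E.
  rewrite (ge0_integral_affine_fun (e := 1) mx)//.
  - by rewrite lee_fin; lra.
  - by move=> g; exact: sqr_ge0.
  - exact: integral_sqr_coord.
have := std_gauss_affine_ge ltr01 (mpsi_obs (vzero n.+2)) mW W0 LW intW.
rewrite (_ : [set g | _ (observation u 1 g)] =
  [set g | psi (observation theta sigma g)]); last first.
  apply/seteqP; split => g /= h'; move: h'; congr (is_true (psi _));
    apply: eq_from_tnth => i; rewrite !tnth_mktuple;
    by case: (i == ord0); field.
have bound (p q : R) : q <= p + 5 / 8 -> 3 / 8 <= p + (1 - q) by lra.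
by move=> h; rewrite lee_fin; apply: bound h.
Qed.

End optimal_radius.

(** * Radius of the GLRT *)

Section dilation.
Context {R : realType} {m : nat}.

Lemma affine_lr_dilation (eta : R) (g : m.-tuple R) :
  affine_lr (vzero m) (expR eta) g =
  expR ((1 - expR (- eta) ^+ 2) / 2 * nsq g - eta * m%:R).
Proof.
rewrite /affine_lr /affine_ratio.
under eq_bigr => i _ do
  rewrite tnth_mktuple subr0 -expRN -expRD exprMn.
rewrite -expR_sum; congr expR.
rewrite big_split /= sumr_const card_ord mulNrn -[eta *+ m]mulr_natr addrC.
congr (_ - _).
by rewrite /nsq mulr_sumr; apply: eq_bigr => i _; field.
Qed.

(* For [eta = O(1 / sqrt m)] the loss is O(1) on average, since [|g|^2] deviates
   from m by O(sqrt m). *)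
Lemma affine_lr_dilation_ge (eta : R) (g : m.-tuple R) : 0 <= eta ->
  1 <= affine_lr (vzero m) (expR eta) g +
    (2 * m%:R * eta ^+ 2 + eta * `|nsq g - m%:R|).
Proof.
move=> eta0; rewrite affine_lr_dilation.
have : (0 : R) <= m%:R by rewrite ler0n.
move: (m%:R : R) => D D0; set N := nsq g; set v := expR (- eta) ^+ 2.
apply: le_trans (lerD (expR_ge1Dx _) (lexx _)).
have vE : v = expR (- (2 * eta)).
  by rewrite /v expr2 -expRD; congr expR; ring.
have v0 : 0 <= v := sqr_ge0 _.
have v1 : 1 - 2 * eta <= v by rewrite vE; apply: expR_ge1Dx.
(* From [v <= 1 / (1 + 2 eta)]. Together with [v1], this controls [(1 - v) / 2 - eta] to second
   order in [eta]. *)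
have v2 : v <= 1 - 2 * eta + 4 * eta ^+ 2.
  have h : v * (1 + 2 * eta) <= 1.
    apply: le_trans (ler_wpM2l v0 (expR_ge1Dx (2 * eta))) _.
    by rewrite vE -expRD addNr expR0.
  nra.
have v3 : v <= 1 by rewrite vE -expR0 ler_expR oppr_le0 mulr_ge0.
have S0 := normr_ge0 (N - D).
have S1 : - `|N - D| <= N - D by rewrite lerNl -normrN ler_norm.
have h1 : - (eta * `|N - D|) <= (1 - v) / 2 * (N - D).
  apply: (@le_trans _ _ (- ((1 - v) / 2 * `|N - D|))).
    by rewrite lerN2 ler_wpM2r//; lra.
  by rewrite -mulrN ler_wpM2l//; lra.
(* Splitting [N] as [D + (N - D)] in the exponent, the first-order terms in [D] cancel and only
   [-2 D eta^2] remains. *)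
have h2 : 0 <= D * ((1 - v) / 2 - eta + 2 * eta ^+ 2) by rewrite mulr_ge0//; lra.
rewrite mulrBr in h1; rewrite !mulrDr mulrN in h2.
lra.
Qed.

End dilation.

Section glr_radius.
Context {R : realType} {n : nat}.
Variables (alpha sigma : R).
Hypotheses (halpha : 0 < alpha < pi / 2) (sigma0 : 0 < sigma).
Local Notation c := (cos alpha).
Local Notation s := (sin alpha).
Local Notation pr A := (fine (std_gauss n.+2 A)).
Local Notation K := (circ_prod_cone n alpha).
Local Notation test := (glr_test sigma [set vzero n.+2] K).
Local Notation w := (Num.sqrt (n.+2%:R : R)).
Local Notation kappa := (@normal_kurt R).

Let T : n.+2.-tuple R -> R := glr_val c s.

Lemma measurable_glr_obs (beta : R) (theta : n.+2.-tuple R) :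
  measurable [set g | test beta (observation theta sigma g)].
Proof.
apply: (measurable_preimageT (B := [set y | test beta y])
  (measurable_observation theta sigma)).
rewrite -[X in measurable X]setTI.
exact: (measurable_glr_test halpha sigma0).
Qed.

Lemma glr_test_obs0 (beta : R) (g : n.+2.-tuple R) :
  test beta (observation (vzero n.+2) sigma g) = (beta <= T g).
Proof.
rewrite glr_test_obs//; congr (_ <= T _); apply: eq_from_tnth => i.
by rewrite !tnth_mktuple mul0r add0r mul1r.
Qed.

(** The hypotheses give [2 d < 17 A W - q], and [34 = 2 * 17] makes this less than [- q / 2]: a
    missed signal forces a large negative inner product with the noise. *)
Lemma type2_alg (A q v d b s2D W : R) : 0 < A -> 34 * (A * W) < q ->
  `|v - s2D| <= 8 * A * W -> v + q + 2 * d <= b -> b < s2D + 9 * A * W ->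
  (q / 4) ^+ 2 <= d ^+ 2.
Proof.
move=> A0 qA; rewrite ler_norml => /andP[h1 h2] h3 h4.
have AW : 0 <= A * W.
  have : 0 <= 8 * A * W.
    by apply: le_trans (_ : `|v - s2D| <= _) => //; rewrite ler_norml h1.
  lra.
have q0 : 0 <= q / 4 by lra.
have : q / 4 <= - d by lra.
by move=> h; rewrite -(sqrrN d) ler_sqr ?nnegrE// (le_trans q0).
Qed.

Lemma eps_GLR_le (rho : R) : 0 < rho <= 1 ->
  (eps_GLR sigma [set vzero n.+2] K rho <=
   (sigma * Num.sqrt (34 * ((2 * kappa + 5) / rho * w)))%:E)%E.
Proof.
move=> /andP[r0 r1]; have [c0 s0 cs] := cos_sin_acute halpha.
have k0 := @normal_kurt_ge0 R.
(* Error budget: [(kappa + 2) / A] for type I, and [(kappa + 2) / A + 1 / A] for type II, adding up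
   to [rho]. *)
set A := (2 * kappa + 5) / rho.
have A1 : 1 <= A by rewrite ler_pdivlMr//; lra.
have A0 : 0 < A by rewrite (lt_le_trans _ A1).
have w1 : 1 <= w := sqrt_dim_ge1; have w0 : 0 < w by rewrite (lt_le_trans _ w1).
have Aw0 : 0 < 34 * (A * w) by rewrite mulr_gt0// mulr_gt0.
set e := Num.sqrt (34 * _).
have ee : e ^+ 2 = 34 * (A * w) by rewrite sqr_sqrtr// ltW.
have e0 : 0 < e by rewrite sqrtr_gt0.
(* The factor 9 puts the threshold strictly above the typical window, whose half-width is
   [8 A w]. *)
pose beta := s ^+ 2 * n.+2%:R + 9 * A * w.
have prat := @pr_atypical R n A A1.
have mat := @measurable_atypical R n A.
apply: (@testing_radius_le R (fun eps =>
    [set uniform_error sigma [set vzero n.+2] K (test beta) eps |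
       beta in [set: R]]) rho _
  (uniform_error sigma [set vzero n.+2] K (test beta) (sigma * e))).
- by rewrite mulr_gt0.
- by exists beta.
have -> : rho = (kappa + 2) / A + ((kappa + 2) / A + 1 / A).
  by rewrite /A; field; rewrite !gt_eqF//; lra.
apply: (uniform_error_le (measurable_glr_test halpha sigma0 beta)).
  apply: le_trans prat; apply: (pr_le _ (measurable_glr_obs _ _) mat) => g.
  rewrite /= glr_test_obs0 => h; apply: contrapT => /(glr_val_typical c0 s0 cs A1).
  rewrite -/(T g) ler_norml => /andP[_].
  have := mulr_gt0 A0 w0; move: h; rewrite /beta.
  move: (s ^+ 2 * n.+2%:R) => z; move: (w) => W; lra.
move=> theta /(circ_prod_coneP _ halpha) thK et.
pose th : n.+2.-tuple R := [tuple tnth theta i / sigma | i < n.+2].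
have thE i : tnth th i = sigma^-1 * tnth theta i by rewrite tnth_mktuple mulrC.
have thK' : in_cone c s th.
  have si0 : 0 <= sigma^-1 by rewrite invr_ge0 ltW.
  by rewrite /in_cone (midnormZ si0 thE) thE -!mulrA ler_wpM2l.
have nth : nsq theta = sigma ^+ 2 * nsq th.
  rewrite /nsq mulr_sumr; apply: eq_bigr => i _.
  by rewrite thE; field; rewrite gt_eqF.
pose q := nsq th.
have qbig : 34 * (A * w) < q.
  have : (sigma * e) ^+ 2 < nsq theta.
    rewrite -[ltRHS]sqr_sqrtr ?nsq_ge0// ltr_sqr ?nnegrE ?sqrtr_ge0//.
    by rewrite mulr_ge0// ltW.
  by rewrite exprMn ee nth ltr_pM2l// exprn_gt0.
have q0 : 0 < q by rewrite (lt_trans Aw0).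
have q40 : 0 < (q / 4) ^+ 2 by rewrite exprn_gt0// divr_gt0.
(* Chebyshev for the inner product with the noise, of variance [q]: the bound is [16 / q], and
   [q > 34 A w >= 16 A]. *)
have qA : nsq th / (q / 4) ^+ 2 <= 1 / A.
  rewrite -/q (_ : q / (q / 4) ^+ 2 = 16 / q); last by field; rewrite gt_eqF.
  rewrite ler_pdivrMr// mulrAC ler_pdivlMr// mul1r.
  have : A <= A * w by rewrite ler_peMr// ltW.
  move=> AAw; apply: le_trans (ltW qbig).
  by apply: ler_pM => //; [exact: ltW|rewrite ler_nat].
have mdot := measurable_ge_set ((q / 4) ^+ 2)
  (measurable_funX 2 (measurable_dot th)).
have prdot := pr_dot_ge th q40.
rewrite -(prC _ (measurable_glr_obs beta theta)).
have := le_trans (prU_le _ mat mdot) (lerD prat (le_trans prdot qA)).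
apply: le_trans.
apply: (pr_le _ (measurableC (measurable_glr_obs beta theta))
  (measurableU _ _ mat mdot)).
move=> g /= /negP; rewrite glr_test_obs// -ltNge -/th => h.
have [|nat] := pselect (atypical A g); first by left.
right; have typ := glr_val_typical c0 s0 cs A1 nat.
have zE i : tnth (observation th 1 g) i = tnth th i + tnth g i.
  by rewrite tnth_mktuple mul1r.
have sup := glr_val_cone_add c0 s0 cs zE thK'.
exact: (type2_alg A0 qbig typ sup h).
Qed.

(** Here [v] is the statistic at [g], [b] the last coordinate of [g] and [t] its shift. Since
    [v >= s2 D / 2], dilation gains at least [tau s2 W]; the shift costs
    [t^2 + 2 t b <= u (1 + 2 A) W], which is no more. *)
Lemma dilation_alg (A tau t u b v s2 D W : R) :
  1 <= A -> 0 <= tau -> 1 <= W -> W ^+ 2 = D -> 0 <= u <= 1 ->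
  0 <= t <= u * W -> t ^+ 2 <= u ^+ 2 * W -> u * (1 + 2 * A) <= tau * s2 ->
  b ^+ 2 < A -> `|v - s2 * D| <= 8 * A * W -> 16 * A <= s2 * W ->
  v - b ^+ 2 + (t + b) ^+ 2 <= expR (tau / W) ^+ 2 * v.
Proof.
move=> A1 tau0 W1 WD /andP[u0 u1] /andP[t0 tu] t2 us bA.
rewrite ler_norml => /andP[v1 _] AW.
have W0 : 0 < W by rewrite (lt_le_trans _ W1).
have vbig : s2 * D / 2 <= v.
  have : 16 * A * W <= s2 * W * W by rewrite ler_wpM2r// ltW.
  have -> : s2 * W * W = s2 * D by rewrite -mulrA -expr2 WD.
  lra.
have s20 : 0 <= s2 * W by apply: le_trans AW; lra.
have sD0 : 0 <= s2 * D by rewrite -WD expr2 mulrA mulr_ge0// ltW.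
have v0 : 0 <= v by apply: le_trans vbig; lra.
have eta0 : 0 <= tau / W by rewrite divr_ge0// ltW.
have L2 : 1 + 2 * (tau / W) <= expR (tau / W) ^+ 2.
  have E : tau / W + tau / W = 2 * (tau / W) by ring.
  by rewrite expr2 -expRD E expR_ge1Dx.
have h1 : v + tau * s2 * W <= expR (tau / W) ^+ 2 * v.
  apply: le_trans (_ : (1 + 2 * (tau / W)) * v <= _); last by rewrite ler_wpM2r.
  rewrite mulrDl mul1r lerD2l.
  have -> : tau * s2 * W = 2 * (tau / W) * (s2 * D / 2).
    by rewrite -WD; field; rewrite gt_eqF.
  by rewrite ler_wpM2l// mulr_ge0.
have bA' : b <= A by nra.
have tb : t * b <= u * W * A.
  apply: le_trans (_ : t * A <= _); first by rewrite ler_wpM2l.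
  by rewrite ler_wpM2r//; lra.
have u2 : u ^+ 2 * W <= u * W by rewrite ler_wpM2r ?(ltW W0)// expr2 ler_piMr.
have h2 : u * (1 + 2 * A) * W <= tau * s2 * W by rewrite ler_wpM2r// ltW.
have -> : v - b ^+ 2 + (t + b) ^+ 2 = v + t ^+ 2 + 2 * (t * b) by ring.
apply: le_trans h1; nra.
Qed.

(** The inequality [S / W <= 1/2 + S^2 / (2 D)] trades the absolute deviation for its square, whose
    mean is known exactly. *)
Lemma deviation_alg (tau W D S : R) : 0 <= tau -> 0 < W -> W ^+ 2 = D ->
  2 * D * (tau / W) ^+ 2 + tau / W * S <=
  2 * tau ^+ 2 + tau / 2 + tau / (2 * D) * S ^+ 2.
Proof.
move=> tau0 W0 <-.
rewrite -subr_ge0 (_ : _ - _ = tau / (2 * W ^+ 2) * (S - W) ^+ 2).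
  by rewrite mulr_ge0 ?sqr_ge0// divr_ge0// mulr_ge0// sqr_ge0.
by field; rewrite gt_eqF.
Qed.

(** Constants of the GLRT lower bound: the dilation exponent is [dilation_rate / sqrt d], the
    atypical event is taken at [dilation_level], the inverse of the rate, and [shift_rate] solves
    [u (1 + 2 A) = tau s^2], as [dilation_alg] demands. *)
Definition dilation_rate : R := (8 * (1 + kappa))^-1.
Definition dilation_level : R := 8 * (1 + kappa).
Definition shift_rate : R :=
  dilation_rate * s ^+ 2 / (1 + 2 * dilation_level).

Lemma uniform_error_glr_ge (beta eps : R) :
  16 * dilation_level <= s ^+ 2 * w ->
  eps < sigma * (shift_rate * Num.sqrt w) ->
  ((3 / 8)%:E <= uniform_error sigma [set vzero n.+2] K (test beta) eps)%E.
Proof.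
have [c0 s0 cs] := cos_sin_acute halpha.
have k0 := @normal_kurt_ge0 R.
set A := dilation_level; set tau := dilation_rate; set u := shift_rate.
have A8 : 8 <= A by rewrite /A /dilation_level; lra.
have A1 : 1 <= A by lra.
have A0 : 0 < A by lra.
have tauA : tau * A = 1 by rewrite mulVf// gt_eqF.
have tau0 : 0 < tau by rewrite invr_gt0.
have s20 : 0 < s ^+ 2 by rewrite exprn_gt0.
have s21 : s ^+ 2 <= 1 by rewrite -cs lerDr sqr_ge0.
have A2 : 0 < 1 + 2 * A by lra.
have u0 : 0 < u by rewrite divr_gt0 ?mulr_gt0.
have uE : u * (1 + 2 * A) = tau * s ^+ 2 by rewrite /u /shift_rate divfK// gt_eqF.
have tau1 : tau <= 1 by rewrite -tauA ler_peMr// ltW.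
have u1 : u <= 1.
  have h : tau * s ^+ 2 <= 1 by rewrite mulr_ile1// ltW.
  rewrite leNgt; apply/negP => u1; nra.
(* As [tau * A = 1], the dilation loss is [2 tau^2 + 1/16] and the atypical event costs at most
   [1/8 + tau]; with [tau <= 1/8] the total stays below [5/8]. *)
have bound (p q : R) : q <= p + (2 * tau ^+ 2 + tau / 2 + tau / 2 * kappa) +
    (kappa + 2) / A -> 3 / 8 <= p + (1 - q).
  have kA : 1 + kappa = A / 8 by rewrite /A /dilation_level; field.
  have tk : tau * kappa = 1 / 8 - tau by nra.
  have t8 : tau <= 1 / 8 by nra.
  have tt : tau ^+ 2 <= 1 / 64 by nra.
  have -> : (kappa + 2) / A = 1 / 8 + tau.
    rewrite (_ : kappa + 2 = (1 / 8 + tau) * A) ?mulfK ?gt_eqF//.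
    by rewrite mulrDl tauA; lra.
  lra.
have w1 : 1 <= w := sqrt_dim_ge1; have w0 : 0 < w by rewrite (lt_le_trans _ w1).
have w2 : w ^+ 2 = n.+2%:R := @sqr_sqrt_dim R n.
set t := u * Num.sqrt w => big epst.
have sw1 : 1 <= Num.sqrt w by rewrite -[leLHS]sqrtr1 ler_wsqrtr.
have sw2 : Num.sqrt w ^+ 2 = w by rewrite sqr_sqrtr// ltW.
have t0 : 0 < t by rewrite mulr_gt0// (lt_le_trans _ sw1).
have t2 : t ^+ 2 <= u ^+ 2 * w by rewrite exprMn sw2.
have tu : t <= u * w.
  by rewrite ler_pM2l// -[leRHS]sw2 expr2 ler_peMl// (le_trans _ sw1).
(* The alternative lies on the line factor, where a shift changes the statistic only through the
   square of the last coordinate. *)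
pose theta : n.+2.-tuple R := basis_vec ord_max (sigma * t).
pose th : n.+2.-tuple R := basis_vec ord_max t.
have st0 : 0 < sigma * t by rewrite mulr_gt0.
have thK : K theta by apply: (basis_vec_cone halpha); [exact: ltW|right].
have ntheta : eps < Num.sqrt (nsq theta).
  by rewrite nsq_basis_vec sqrtr_sqr gtr0_norm.
have lower := uniform_error_ge sigma (measurable_glr_test halpha sigma0 beta)
  thK ntheta.
apply: (le_trans _ lower) => {lower}.
pose lam := expR (tau / w).
have lam0 : 0 < lam := expR_gt0 _.
have eta0 : 0 <= tau / w by rewrite divr_ge0 ?ltW.
pose W (g : n.+2.-tuple R) : R :=
  (2 * tau ^+ 2 + tau / 2) + tau / (2 * n.+2%:R) * (nsq g - n.+2%:R) ^+ 2.
have mS : measurable_fun [set: n.+2.-tuple R] (fun g => (nsq g - n.+2%:R : R) ^+ 2).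
  by apply: measurable_funX; apply: measurable_funB => //; exact: measurable_nsq.
have mW : measurable_fun [set: n.+2.-tuple R] W.
  by apply: measurable_funD => //; exact: measurable_funM.
have a0 : 0 <= 2 * tau ^+ 2 + tau / 2.
  by rewrite addr_ge0 ?mulr_ge0 ?divr_ge0 ?sqr_ge0 ?(ltW tau0).
have b0 : 0 <= tau / (2 * n.+2%:R) by rewrite divr_ge0 ?mulr_ge0 ?(ltW tau0).
have W0 g : 0 <= W g by rewrite addr_ge0// mulr_ge0// sqr_ge0.
have LW g : 1 <= affine_lr (vzero n.+2) lam g + W g.
  apply: le_trans (affine_lr_dilation_ge g eta0) _; rewrite lerD2l /W.
  have S2 : `|nsq g - n.+2%:R| ^+ 2 = (nsq g - n.+2%:R) ^+ 2.
    by rewrite real_normK ?num_real.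
  by rewrite -S2; exact: (deviation_alg _ (ltW tau0) w0 w2).
have intW : (\int[std_gauss n.+2]_g (W g)%:E <=
    (2 * tau ^+ 2 + tau / 2 + tau / 2 * kappa)%:E)%E.
  rewrite (ge0_integral_affine_fun (e := kappa *+ n.+2) mS)//.
  - rewrite lee_fin lerD2l -mulr_natr le_eqVlt; apply/orP; left; apply/eqP.
    by field; rewrite gt_eqF// ltr0n.
  - by move=> g; exact: sqr_ge0.
  - by rewrite -integral_std_gauss_chi2; under eq_integral do rewrite nsqB.
have mA := measurable_glr_obs beta (vzero n.+2).
have mB := measurable_glr_obs beta theta.
have mA' := measurable_preimageT (measurable_observation (vzero n.+2) lam) mA.
have mat := @measurable_atypical R n A.
have stepdil := std_gauss_affine_ge lam0 mA mW W0 LW intW.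
have stepU := le_trans (prU_le (std_gauss n.+2) mA' mat)
  (lerD stepdil (pr_atypical A1)).
(* Pathwise comparison: off the atypical event, if the test rejects under the alternative with noise
   [g], it also rejects under the null with the dilated noise. The probability of the latter is
   close to the type I error by [stepdil]. *)
have sub : [set g | test beta (observation theta sigma g)] `<=`
  [set g | [set g' | test beta (observation (vzero n.+2) sigma g')]
     (observation (vzero n.+2) lam g)] `|` atypical A.
  move=> g /=; rewrite glr_test_obs0 glr_test_obs// => h.
  have [|nat] := pselect (atypical A g); first by right.
  left; apply: le_trans h _.
  have typ := glr_val_typical c0 s0 cs A1 nat.
  have bA : tnth g ord_max ^+ 2 < A.
    by rewrite ltNge; apply/negP => bA; apply: nat; left; right.
  have lE i : tnth (observation (vzero n.+2) lam g) i = lam * tnth g i.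
    by rewrite !tnth_mktuple add0r.
  rewrite /T (glr_val_scale c s lam0 lE).
  rewrite (@glr_val_shift_last _ _ c s g); last first.
    by move=> i im; rewrite !tnth_mktuple (negbTE im) mul0r add0r mul1r.
  rewrite !tnth_mktuple eqxx mul1r (mulrC sigma) mulfK ?gt_eqF//.
  by apply: (dilation_alg A1 (ltW tau0) w1 w2 _ _ t2 _ bA typ big);
    rewrite ?(ltW u0) ?(ltW t0) ?uE.
have final := le_trans
  (pr_le (std_gauss n.+2) mB (measurableU _ _ mA' mat) sub) stepU.
by rewrite lee_fin; apply: bound final.
Qed.

End glr_radius.

(** * Two-sided bounds on the radii *)

Section radius_bounds.
Context {R : realType}.

Lemma ereal_between (a b : R) (x : \bar R) :
  (a%:E <= x <= b%:E)%E -> exists2 r, x = r%:E & a <= r <= b.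
Proof.
case: x => [r| |] /andP[]; rewrite ?lee_fin ?leNye// => ar rb.
by exists r => //; rewrite ar.
Qed.

Lemma sqre_between (a b : R) (x : \bar R) : 0 <= a ->
  (a%:E <= x <= b%:E)%E -> ((a ^+ 2)%:E <= x ^+ 2 <= (b ^+ 2)%:E)%E.
Proof.
move=> a0 /ereal_between[r -> /andP[ar rb]]; rewrite -EFin_expe !lee_fin.
have r0 := le_trans a0 ar.
by rewrite !ler_sqr ?nnegrE ?ar ?rb// (le_trans r0).
Qed.

Variables (alpha rho : R).
Hypotheses (halpha : 0 < alpha < pi / 2) (hrho : 0 < rho <= 11%:R / 100%:R).

Let rho_lt : rho < 3 / 8. Proof. by move: hrho => /andP[_]; lra. Qed.

Lemma eps_OPT_between (n : nat) (sigma : R) : 0 < sigma ->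
  ((sigma / 2)%:E <=
     eps_OPT sigma [set vzero n.+2] (circ_prod_cone n alpha) rho <=
   (sigma * Num.sqrt (32 / (rho * cos alpha ^+ 2)))%:E)%E.
Proof.
move=> sigma0; apply/andP; split; last first.
  by apply: eps_OPT_le => //; move: hrho => /andP[].
apply: (@testing_radius_ge R (fun eps =>
  [set uniform_error sigma [set vzero n.+2] (circ_prod_cone n alpha) psi eps |
    psi in [set psi | measurable_fun [set: n.+2.-tuple R] psi]]) rho (3 / 8)) => //.
move=> eps _ /andP[_ epss] [psi mpsi <-].
exact: (uniform_error_ge_small_radius halpha sigma0).
Qed.

Let lev := 16 * @dilation_level R / sin alpha ^+ 2.

(** If [sqrt d >= lev], the dilation argument applies and gives the rate [shift_rate^2]. If
    [sqrt d < lev], the bound [sigma^2 / 4] valid for every test is at least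
    [sigma^2 sqrt d / (4 lev)]. *)
Definition glr_lower_rate : R :=
  Num.min (1 / (4 * lev)) (shift_rate alpha ^+ 2).

Lemma glr_lower_rate_gt0 : 0 < glr_lower_rate.
Proof.
have [c0 s0 cs] := cos_sin_acute halpha; have k0 := @normal_kurt_ge0 R.
have l0 : 0 < @dilation_level R by rewrite /dilation_level; lra.
have u0 : 0 < shift_rate alpha.
  rewrite /shift_rate divr_gt0// ?mulr_gt0 ?exprn_gt0 ?invr_gt0//; lra.
rewrite lt_min exprn_gt0// andbT divr_gt0// mulr_gt0//.
have s20 : 0 < sin alpha ^+ 2 by rewrite exprn_gt0.
have L0 : 0 < 16 * @dilation_level R by rewrite mulr_gt0.
exact: divr_gt0.
Qed.

Lemma eps_GLR_between (n : nat) (sigma : R) : 0 < sigma ->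
  ((sigma * Num.sqrt (glr_lower_rate * Num.sqrt n.+2%:R))%:E <=
     eps_GLR sigma [set vzero n.+2] (circ_prod_cone n alpha) rho <=
   (sigma *
     Num.sqrt (34 * ((2 * normal_kurt + 5) / rho * Num.sqrt n.+2%:R)))%:E)%E.
Proof.
move=> sigma0; have [c0 s0 cs] := cos_sin_acute halpha.
have k0 := @normal_kurt_ge0 R.
have s20 : 0 < sin alpha ^+ 2 by rewrite exprn_gt0.
have l0 : 0 < @dilation_level R by rewrite /dilation_level; lra.
have lev0 : 0 < lev by rewrite divr_gt0// mulr_gt0.
have rate0 := glr_lower_rate_gt0.
apply/andP; split; last first.
  by apply: eps_GLR_le => //; move: hrho => /andP[-> ?] /=; lra.
have w0 : 0 <= Num.sqrt n.+2%:R :> R by rewrite sqrtr_ge0.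
apply: (@testing_radius_ge R (fun eps =>
  [set uniform_error sigma [set vzero n.+2] (circ_prod_cone n alpha)
     (glr_test sigma [set vzero n.+2] (circ_prod_cone n alpha) beta) eps |
    beta in [set: R]]) rho (3 / 8)) => //.
move=> eps _ /andP[_ epss] [beta _ <-].
have [big|small] := leP (16 * @dilation_level R) (sin alpha ^+ 2 * Num.sqrt n.+2%:R).
  apply: (uniform_error_glr_ge halpha sigma0 beta big); apply: (lt_le_trans epss).
  rewrite ler_pM2l//.
  have u0 : 0 <= shift_rate alpha.
    rewrite /shift_rate divr_ge0// ?mulr_ge0 ?sqr_ge0 ?invr_ge0//; lra.
  rewrite -[shift_rate alpha in leRHS](ger0_norm u0) -sqrtr_sqr -sqrtrM ?sqr_ge0//.
  by rewrite ler_wsqrtr// ler_wpM2r// ge_min lexx orbT.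
apply: (uniform_error_ge_small_radius halpha sigma0).
  exact: (measurable_glr_test halpha sigma0).
apply: (lt_le_trans epss); rewrite ler_pM2l//.
have -> : 2^-1 = Num.sqrt (2^-1 ^+ 2) :> R by rewrite sqrtr_sqr ger0_norm.
apply: ler_wsqrtr.
have wlev : Num.sqrt n.+2%:R <= lev.
  by rewrite /lev ler_pdivlMr// mulrC ltW.
apply: le_trans (_ : 1 / (4 * lev) * lev <= _).
  by apply: ler_pM => //; [exact: ltW|rewrite ge_min lexx].
by rewrite le_eqVlt; apply/orP; left; apply/eqP; field; rewrite gt_eqF.
Qed.

Lemma radii_bounds : exists c C : R, 0 < c <= C /\
  forall (n : nat) (sigma : R), 0 < sigma ->
    let GLR := eps_GLR sigma [set vzero n.+2] (circ_prod_cone n alpha) rho in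
    let OPT := eps_OPT sigma [set vzero n.+2] (circ_prod_cone n alpha) rho in
    ((c * sigma ^+ 2 * Num.sqrt n.+2%:R)%:E <= GLR ^+ 2
       <= (C * sigma ^+ 2 * Num.sqrt n.+2%:R)%:E)%E /\
    ((c * sigma ^+ 2)%:E <= OPT ^+ 2 <= (C * sigma ^+ 2)%:E)%E.
Proof.
have [c0 s0 cs] := cos_sin_acute halpha; have k0 := @normal_kurt_ge0 R.
have r0 : 0 < rho by move: hrho => /andP[].
have rate0 := glr_lower_rate_gt0.
set C1 := 32 / (rho * cos alpha ^+ 2).
set C2 := 34 * ((2 * @normal_kurt R + 5) / rho).
have C10 : 0 <= C1 by rewrite divr_ge0// mulr_ge0 ?sqr_ge0 ?(ltW r0).
have C20 : 0 <= C2 by rewrite mulr_ge0// divr_ge0 ?(ltW r0)//; lra.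
(* One pair of constants serves both radii; the summand 1 ensures [c <= C], as [c <= 1/4]. *)
exists (Num.min (1 / 4) glr_lower_rate), (1 + C1 + C2); split.
  rewrite lt_min rate0 divr_gt0//= ge_min; apply/orP; left; lra.
move=> n sigma sigma0 /=.
have sig2 : 0 <= sigma ^+ 2 by rewrite sqr_ge0.
have w0 : 0 <= Num.sqrt n.+2%:R :> R by rewrite sqrtr_ge0.
split.
  have rw : 0 <= glr_lower_rate * Num.sqrt n.+2%:R by rewrite mulr_ge0// ltW.
  have Cw : 0 <= 34 * ((2 * @normal_kurt R + 5) / rho * Num.sqrt n.+2%:R).
    by rewrite mulrA mulr_ge0.
  have low0 : 0 <= sigma * Num.sqrt (glr_lower_rate * Num.sqrt n.+2%:R).
    by rewrite mulr_ge0 ?sqrtr_ge0// ltW.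
  have /andP[lo up] := sqre_between low0 (eps_GLR_between n sigma0).
  apply/andP; split.
    apply: le_trans lo; rewrite lee_fin exprMn sqr_sqrtr//.
    rewrite (mulrC (sigma ^+ 2)) [leLHS]mulrAC.
    by do 2 apply: ler_wpM2r => //; rewrite ge_min lexx orbT.
  apply: (le_trans up); rewrite lee_fin exprMn sqr_sqrtr// (mulrA 34) -/C2.
  rewrite (mulrC (sigma ^+ 2)) [leRHS]mulrAC.
  by do 2 apply: ler_wpM2r => //; lra.
have low0 : 0 <= sigma / 2 by rewrite divr_ge0// ltW.
have /andP[lo up] := sqre_between low0 (eps_OPT_between n sigma0).
apply/andP; split.
  apply: le_trans lo; rewrite lee_fin (_ : (sigma / 2) ^+ 2 = 1 / 4 * sigma ^+ 2).
    by rewrite ler_wpM2r// ge_min lexx.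
  by field.
apply: (le_trans up); rewrite lee_fin exprMn sqr_sqrtr// mulrC -/C1.
by apply: ler_wpM2r => //; lra.
Qed.

End radius_bounds.

(* The dimension d >= 2 is n.+2. *)
Theorem mainTheorem6 (R : realType) (alpha rho : R)
  (halpha : 0 < alpha < pi / 2) (hrho : 0 < rho <= 11%:R / 100%:R) :
  (exists c C : R, 0 < c <= C /\
    forall (n : nat) (sigma : R), 0 < sigma ->
      let GLR := eps_GLR sigma [set vzero n.+2] (circ_prod_cone n alpha) rho in
      let OPT := eps_OPT sigma [set vzero n.+2] (circ_prod_cone n alpha) rho in
      ((c * sigma ^+ 2 * Num.sqrt n.+2%:R)%:E <= GLR ^+ 2
         <= (C * sigma ^+ 2 * Num.sqrt n.+2%:R)%:E)%E /\
      ((c * sigma ^+ 2)%:E <= OPT ^+ 2 <= (C * sigma ^+ 2)%:E)%E) /\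
  (exists k K : R, 0 < k <= K /\
    forall (n : nat) (sigma : R), 0 < sigma ->
      let GLR := eps_GLR sigma [set vzero n.+2] (circ_prod_cone n alpha) rho in
      let OPT := eps_OPT sigma [set vzero n.+2] (circ_prod_cone n alpha) rho in
      ((k * Num.sqrt n.+2%:R)%:E * OPT ^+ 2 <= GLR ^+ 2
         <= (K * Num.sqrt n.+2%:R)%:E * OPT ^+ 2)%E).
Proof.
have [c [C [cC bounds]]] := radii_bounds halpha hrho.
split; first by exists c, C.
move: cC => /andP[c0 cC]; have C0 := lt_le_trans c0 cC.
have cC1 : c / C <= 1 by rewrite ler_pdivrMr ?mul1r.
have Cc1 : 1 <= C / c by rewrite ler_pdivlMr ?mul1r.
(* Both squared radii are finite and known up to factors in [[c, C]], so their ratio is [sqrt d] up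
   to factors in [[c / C, C / c]]. *)
exists (c / C), (C / c); split; first by rewrite divr_gt0//= (le_trans cC1).
move=> n sigma sigma0; cbv zeta.
have [/ereal_between[g -> /andP[g1 g2]]] := bounds n sigma sigma0.
move=> /ereal_between[r -> /andP[h1 h2]].
rewrite -!EFinM !lee_fin; have w0 : 0 <= Num.sqrt n.+2%:R :> R by rewrite sqrtr_ge0.
apply/andP; split.
  apply: le_trans g1.
  have -> : c * sigma ^+ 2 * Num.sqrt n.+2%:R =
      c / C * Num.sqrt n.+2%:R * (C * sigma ^+ 2).
    by field; rewrite gt_eqF.
  by rewrite ler_wpM2l// mulr_ge0// divr_ge0 ?ltW.
apply: (le_trans g2).
have -> : C * sigma ^+ 2 * Num.sqrt n.+2%:R =
    C / c * Num.sqrt n.+2%:R * (c * sigma ^+ 2).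
  by field; rewrite gt_eqF.
by rewrite ler_wpM2l// mulr_ge0// divr_ge0 ?ltW.
Qed.
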